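(* Let $f,g\in L^2(\mathbb{R}^2;\mathbb{H})$ (both also integrable, i.e. $\int_{\mathbb{R}^2}|f|\,d^2\mathbf{x}<\infty$ and $\int_{\mathbb{R}^2}|g|\,d^2\mathbf{x}<\infty$), with quaternion Fourier transforms $\hat f,\hat g$. Then $$\langle f,g\rangle=\frac{1}{(2\pi)^2}\,\langle \hat f,\hat g\rangle .$$
   Context: $\mathbb{H}$ is the real quaternion algebra with units $i,j,k$, $ij=-ji=k$, $jk=-kj=i$, $ki=-ik=j$, $i^2=j^2=k^2=ijk=-1$. For $q=q_r+q_i i+q_j j+q_k k$ with real coefficients, the conjugate is $\tilde q=q_r-q_i i-q_j j-q_k k$, the norm is $|q|=\sqrt{q\tilde q}$, and $\langle q\rangle_0=q_r$ is the real scalar part. $L^2(\mathbb{R}^2;\mathbb{H})$ is the set of functions $f:\mathbb{R}^2\to\mathbb{H}$ with $\int_{\mathbb{R}^2}|f(\mathbf{x})|^2\,d^2\mathbf{x}<\infty$. The real scalar product is $\langle f,g\rangle=\int_{\mathbb{R}^2}\langle f(\mathbf{x})\,\tilde g(\mathbf{x})\rangle_0\,d^2\mathbf{x}$, where $\tilde g(\mathbf{x})$ is the quaternion conjugate of $g(\mathbf{x})$. For $\mathbf{x}=(x,y)$ and $\mathbf{u}=(u,v)$ in $\mathbb{R}^2$, the quaternion Fourier transform (QFT) of $f$ is $$\hat f(\mathbf{u})=\int_{\mathbb{R}^2}e^{-i xu}\,f(\mathbf{x})\,e^{-j yv}\,d^2\mathbf{x},\qquad d^2\mathbf{x}=dx\,dy.$$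 *)

(* Defs.v *)
From HB Require Import structures.
From mathcomp Require Import all_boot all_order all_algebra.
From mathcomp Require Import ring lra.
From mathcomp Require Import all_classical all_reals all_analysis.
Set Implicit Arguments.
Unset Strict Implicit.
Unset Printing Implicit Defensive.
Import Order.TTheory GRing.Theory Num.Theory.
Import numFieldNormedType.Exports.
Local Open Scope classical_set_scope.
Local Open Scope ring_scope.

(* The quaternion q_r + q_i i + q_j j + q_k k. *)
Record quat (R : Type) := Quat { qr : R; qi : R; qj : R; qk : R }.

Section QuatAlgebra.
Variable R : realType.
Implicit Types (p q s : quat R) (a b : R).

Definition quat_to_prod q : R * R * R * R := (qr q, qi q, qj q, qk q).
Definition prod_to_quat (t : R * R * R * R) : quat R :=
  Quat t.1.1.1 t.1.1.2 t.1.2 t.2.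
Lemma quat_to_prodK : cancel quat_to_prod prod_to_quat. Proof. by case. Qed.
HB.instance Definition _ := Choice.copy (quat R) (can_type quat_to_prodK).

Definition qzero : quat R := Quat 0 0 0 0.
Definition qone : quat R := Quat 1 0 0 0.
Definition qopp q := Quat (- qr q) (- qi q) (- qj q) (- qk q).
Definition qadd p q :=
  Quat (qr p + qr q) (qi p + qi q) (qj p + qj q) (qk p + qk q).
Definition qmul p q := Quat
  (qr p * qr q - qi p * qi q - qj p * qj q - qk p * qk q)
  (qr p * qi q + qi p * qr q + qj p * qk q - qk p * qj q)
  (qr p * qj q - qi p * qk q + qj p * qr q + qk p * qi q)
  (qr p * qk q + qi p * qj q - qj p * qi q + qk p * qr q).
Definition qscale a q := Quat (a * qr q) (a * qi q) (a * qj q) (a * qk q).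

Lemma qaddA : associative qadd.
Proof. by move=> p q s; rewrite /qadd /= !addrA. Qed.
Lemma qaddC : commutative qadd.
Proof. by move=> p q; congr Quat; rewrite addrC. Qed.
Lemma qadd0 : left_id qzero qadd.
Proof. by case=> *; rewrite /qadd /= !add0r. Qed.
Lemma qaddN : left_inverse qzero qopp qadd.
Proof. by move=> q; rewrite /qadd /= !addNr. Qed.
HB.instance Definition _ :=
  GRing.isZmodule.Build (quat R) qaddA qaddC qadd0 qaddN.

Lemma qmulA : associative qmul.
Proof. by move=> p q s; congr Quat => /=; ring. Qed.
Lemma qmul1l : left_id qone qmul.
Proof. by case=> *; congr Quat => /=; ring. Qed.
Lemma qmul1r : right_id qone qmul.
Proof. by case=> *; congr Quat => /=; ring. Qed.
Lemma qmulDl : left_distributive qmul +%R.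
Proof. by move=> p q s; congr Quat => /=; ring. Qed.
Lemma qmulDr : right_distributive qmul +%R.
Proof. by move=> p q s; congr Quat => /=; ring. Qed.
Lemma qone_neq0 : qone != 0 :> quat R.
Proof. by apply/eqP => -[] /eqP; rewrite oner_eq0. Qed.
HB.instance Definition _ := GRing.Zmodule_isNzRing.Build (quat R)
  qmulA qmul1l qmul1r qmulDl qmulDr qone_neq0.

Lemma qscaleA a b q : qscale a (qscale b q) = qscale (a * b) q.
Proof. by rewrite /qscale /= !mulrA. Qed.
Lemma qscale1 : left_id 1 qscale.
Proof. by case=> *; rewrite /qscale /= !mul1r. Qed.
Lemma qscaleDr : right_distributive qscale +%R.
Proof. by move=> a p q; congr Quat => /=; rewrite mulrDr. Qed.
Lemma qscaleDl q : {morph qscale^~ q : a b / a + b}.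
Proof. by move=> a b; congr Quat => /=; rewrite mulrDl. Qed.
HB.instance Definition _ := GRing.Zmodule_isLmodule.Build R (quat R)
  qscaleA qscale1 qscaleDr qscaleDl.

Lemma qscaleAl a p q : a *: (p * q) = a *: p * q.
Proof. by congr Quat => /=; ring. Qed.
HB.instance Definition _ := GRing.Lmodule_isLalgebra.Build R (quat R) qscaleAl.
Lemma qscaleAr a p q : a *: (p * q) = p * (a *: q).
Proof. by congr Quat => /=; ring. Qed.
HB.instance Definition _ := GRing.Lalgebra_isAlgebra.Build R (quat R) qscaleAr.

Definition unit_i : quat R := Quat 0 1 0 0.
Definition unit_j : quat R := Quat 0 0 1 0.
Definition unit_k : quat R := Quat 0 0 0 1.

Lemma quat_relations :
  [/\ unit_i * unit_j = unit_k /\ unit_j * unit_i = - unit_k,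
      unit_j * unit_k = unit_i /\ unit_k * unit_j = - unit_i,
      unit_k * unit_i = unit_j /\ unit_i * unit_k = - unit_j,
      [/\ unit_i ^+ 2 = -1, unit_j ^+ 2 = -1 & unit_k ^+ 2 = -1] &
      unit_i * unit_j * unit_k = -1].
Proof. by do !split; congr Quat => /=; ring. Qed.

Definition qconj q := Quat (qr q) (- qi q) (- qj q) (- qk q).

(* q * qconj q is real, see mulq_conj. *)
Definition qnorm q : R := Num.sqrt (qr (q * qconj q)).

Lemma mulq_conj q : q * qconj q = (qnorm q ^+ 2)%:A.
Proof.
have E : qr (q * qconj q) = qr q ^+ 2 + qi q ^+ 2 + qj q ^+ 2 + qk q ^+ 2.
  by rewrite /=; ring.
rewrite /qnorm sqr_sqrtr; first by congr Quat => /=; ring.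
by rewrite E !addr_ge0 ?sqr_ge0.
Qed.

(* The exponential series, summed component by component. *)
Definition qexp_coeff q (n : nat) : quat R := n`!%:R^-1 *: q ^+ n.
Definition qexp q : quat R := Quat
  (limn (series (fun n => qr (qexp_coeff q n))))
  (limn (series (fun n => qi (qexp_coeff q n))))
  (limn (series (fun n => qj (qexp_coeff q n))))
  (limn (series (fun n => qk (qexp_coeff q n)))).

Lemma exprn_i a n : (a *: unit_i) ^+ n =
  Quat ((~~ odd n)%:R * (-1) ^+ n./2 * a ^+ n)
       ((odd n)%:R * (-1) ^+ n.-1./2 * a ^+ n) 0 0.
Proof.
elim: n => [|n IH]; first by congr Quat; rewrite /= ?expr0; ring.
rewrite exprSr IH /= uphalf_half.
case: n {IH} => [|n] /=; first by congr Quat => /=; ring.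
by rewrite uphalf_half; case: (odd n) => /=; congr Quat => /=;
  rewrite ?add0n ?add1n ?exprS /=; ring.
Qed.

Lemma exprn_j a n : (a *: unit_j) ^+ n =
  Quat ((~~ odd n)%:R * (-1) ^+ n./2 * a ^+ n) 0
       ((odd n)%:R * (-1) ^+ n.-1./2 * a ^+ n) 0.
Proof.
elim: n => [|n IH]; first by congr Quat; rewrite /= ?expr0; ring.
rewrite exprSr IH /= uphalf_half.
case: n {IH} => [|n] /=; first by congr Quat => /=; ring.
by rewrite uphalf_half; case: (odd n) => /=; congr Quat => /=;
  rewrite ?add0n ?add1n ?exprS /=; ring.
Qed.

Lemma limn_series0 (u : nat -> R) : (forall n, u n = 0) -> limn (series u) = 0.
Proof.
move=> u0; have -> : series u = cst 0.
  by apply/funext => n; rewrite /series /= big1.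
by apply: cvg_lim; [exact: Rhausdorff | exact: cvg_cst].
Qed.

Lemma eq_limn_series (u v : nat -> R) :
  u =1 v -> limn (series u) = limn (series v).
Proof. by move=> /funext ->. Qed.

Lemma qexp_i a : qexp (a *: unit_i) = Quat (cos a) (sin a) 0 0.
Proof.
rewrite /qexp /qexp_coeff cos.unlock sin.unlock; congr Quat; last 2 first.
- by apply: limn_series0 => n; rewrite exprn_i /= mulr0.
- by apply: limn_series0 => n; rewrite exprn_i /= mulr0.
- by apply: eq_limn_series => n; rewrite exprn_i /= mulrC.
- by apply: eq_limn_series => n; rewrite exprn_i /= mulrC.
Qed.

Lemma qexp_j a : qexp (a *: unit_j) = Quat (cos a) 0 (sin a) 0.
Proof.
rewrite /qexp /qexp_coeff cos.unlock sin.unlock; congr Quat.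
- by apply: eq_limn_series => n; rewrite exprn_j /= mulrC.
- by apply: limn_series0 => n; rewrite exprn_j /= mulr0.
- by apply: eq_limn_series => n; rewrite exprn_j /= mulrC.
- by apply: limn_series0 => n; rewrite exprn_j /= mulr0.
Qed.

End QuatAlgebra.

Section QuatFourier.
Variable R : realType.

Definition plane := (measurableTypeR R * measurableTypeR R)%type.

Definition lebesgue2 : set plane -> \bar R :=
  (@lebesgue_measure R \x @lebesgue_measure R)%E.
HB.instance Definition _ := Measure.on lebesgue2.

Implicit Types f g : plane -> quat R.

Definition borel_quat f : Prop :=
  [/\ measurable_fun setT (fun x => qr (f x) : measurableTypeR R),
      measurable_fun setT (fun x => qi (f x) : measurableTypeR R),
      measurable_fun setT (fun x => qj (f x) : measurableTypeR R) &
      measurable_fun setT (fun x => qk (f x) : measurableTypeR R)].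

(* Lebesgue measurability, i.e. measurability for the completion of lebesgue2:
   the library's product measure lives on the Borel sets.  The library's
   integral is a supremum over Borel simple functions, so it is the Lebesgue
   integral for these functions as well. *)
Definition measurable_quat f : Prop :=
  exists2 f0, borel_quat f0 & {ae lebesgue2, forall x, f x = f0 x}.

Definition in_L1 f : Prop :=
  measurable_quat f /\ (\int[lebesgue2]_x (qnorm (f x))%:E < +oo)%E.

Definition in_L2 f : Prop :=
  measurable_quat f /\ (\int[lebesgue2]_x (qnorm (f x) ^+ 2)%:E < +oo)%E.

(* Extended-real valued, so that an equation with a finite side also asserts
   that the other integral converges; it is finite for f and g in L2. *)
Definition qscalar_product f g : \bar R :=
  (\int[lebesgue2]_x (qr (f x * qconj (g x)))%:E)%E.

Definition qintegral f : quat R := Quat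
  (\int[lebesgue2]_x qr (f x)) (\int[lebesgue2]_x qi (f x))
  (\int[lebesgue2]_x qj (f x)) (\int[lebesgue2]_x qk (f x)).

Definition qft f : plane -> quat R := fun u => qintegral (fun x =>
  qexp (- (x.1 * u.1) *: unit_i R) * f x * qexp (- (x.2 * u.2) *: unit_j R)).

End QuatFourier.

(* Main.v *)
Require Import Defs.
From mathcomp Require Import all_boot all_order all_algebra.
From mathcomp Require Import ring lra.
From mathcomp Require Import all_classical all_reals all_analysis.
From mathcomp Require Import measurable_realfun.
Set Implicit Arguments.
Unset Strict Implicit.
Unset Printing Implicit Defensive.
Import Order.TTheory GRing.Theory Num.Theory.
Import numFieldNormedType.Exports.
Local Open Scope classical_set_scope.
Local Open Scope ring_scope.

(* In one variable, let h be in L^1 and L^2 with autocorrelation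
   r(t) = \int h(x) h(x + t) dx.  By Fubini the squared modulus of the Fourier
   transform of h is \int r(t) cos(t u) dt; integrating it over u >= 0 against
   exp(-c u) gives \int r(t) c / (c^2 + t^2) dt = \int r(c s) / (1 + s^2) ds.
   As c tends to 0 the left side increases to the integral of the squared
   modulus, and the right side tends to pi r(0) because r is bounded and
   continuous at 0, translation being continuous in L^2.  This is Plancherel for
   real h; the cross terms of a complex h are odd in u and cancel.

   The quaternion transform is a complex transform in x (with respect to i, on
   the left) followed by one in y (with respect to j, on the right).  Applying
   the one-variable theorem to almost every slice, with Tonelli, shows that it
   multiplies the L^2 norm by 2 pi; polarization gives the scalar product. *)

(** * Affine changes of variable *)

(** Without damping, [cos (t * u) * autocorr h t] has no decay in [u], so Fubini cannot exchange the
    two variables, and integrability of the squared modulus is not known beforehand. The exponential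
    is chosen because it increases to 1 as [c] decreases to 0 and because its cosine transform has
    an elementary antiderivative. The resulting kernel [1 / (1 + s^2)] has mass pi, which gives pi
    on a half line for real [h], [2 pi] on the line and [(2 pi)^2] on the plane. In two variables
    the obstacle is that the transform in [x] is integrable in [y] for each frequency, but need not
    be integrable on the plane. The slice theorem therefore asks only for integrable slices and a
    finite total square integral; the first pass supplies the latter for the second. Left
    multiplication by [i] couples the components r, i and j, k, right multiplication by [j] couples
    r, j and i, k, so the four squares are regrouped between the two passes. *)

Lemma gt0_muleB (R : realDomainType) (a : R) (x y : \bar R) : 0 < a ->
  (a%:E * x - a%:E * y = a%:E * (x - y))%E.
Proof.
move=> a0; case: x y => [x||] [y||];
  last by rewrite /= !gt0_muleNy ?lte_fin//= gt0_muley ?lte_fin.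
all: try by rewrite /= ?gt0_muley ?gt0_muleNy ?lte_fin//= ?gt0_muley ?gt0_muleNy
  ?lte_fin.
exact: (congr1 EFin (esym (mulrBr _ _ _))).
Qed.

Section affine_change_of_variable.
Context {R : realType}.
Notation mu := (@lebesgue_measure R).
Implicit Types f : R -> \bar R.

Definition affine (a b x : R) : R := a * x + b.

Lemma measurable_affine a b : measurable_fun [set: R] (affine a b).
Proof.
by apply: measurable_funD => //; apply: measurable_funM.
Qed.

Let mR : measurableType _ := measurableTypeR R.

Let mphi a b : measurable_fun [set: mR] (affine a b : mR -> mR).
Proof. exact: measurable_affine. Qed.

Let scaled a b (a0 : 0 <= a) : {measure set mR -> \bar R} :=
  mscale (NngNum a0)
    (measure_function_pushforward__canonical__measure_function_Measure mu
      (mphi a b)).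

Lemma preimage_affine_oc (a b c d : R) : 0 < a ->
  affine a b @^-1` `]c, d] = `](c - b) / a, (d - b) / a]%classic.
Proof.
move=> a0; apply/seteqP; split => x /=; rewrite !in_itv/= /affine.
  by rewrite ltr_pdivrMr// ler_pdivlMr// ltrBlDr lerBrDr (mulrC x).
by rewrite ltr_pdivrMr// ler_pdivlMr// ltrBlDr lerBrDr (mulrC x).
Qed.

(** The scaled pushforward [scaled] gives every half-open interval its length, and Lebesgue measure
    is the only measure that does. *)
Lemma lebesgue_measure_affine a b (A : set R) : 0 < a -> measurable A ->
  (mu A = a%:E * mu (affine a b @^-1` A))%E.
Proof.
move=> a0 mA.
pose nu := scaled b (ltW a0).
have := @lebesgue_measure_unique R nu _ A mA; apply => _ [[c d] _ <-] /=.
rewrite /mscale/= /pushforward/=.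
have [cd|dc] := ltP c d; last first.
  by rewrite set_itv_ge ?bnd_simp -?leNgt// preimage_set0 !measure0 mule0.
rewrite lebesgue_measure_itv/= lte_fin cd.
rewrite preimage_affine_oc// lebesgue_measure_itv/= lte_fin.
rewrite ltr_pM2r ?invr_gt0// ltrD2r cd -!EFinD -EFinM; congr EFin.
by field; rewrite gt_eqF.
Qed.

Lemma ge0_integral_affine a b f : 0 < a ->
  measurable_fun [set: R] f -> (forall x, (0 <= f x)%E) ->
  (\int[mu]_x f x = a%:E * \int[mu]_x f (affine a b x))%E.
Proof.
move=> a0 mf f0.
pose nu := scaled b (ltW a0).
transitivity (\int[nu]_x f x)%E.
  by apply: eq_measure_integral => A mA _; exact: lebesgue_measure_affine.
rewrite ge0_integral_mscale//=; congr (_ * _)%E.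
by rewrite (ge0_integral_pushforward (mphi a b)).
Qed.

Lemma integral_affine a b f : 0 < a -> measurable_fun [set: R] f ->
  (\int[mu]_x f x = a%:E * \int[mu]_x f (affine a b x))%E.
Proof.
move=> a0 mf; rewrite integralE [in RHS]integralE.
rewrite (ge0_integral_affine b a0 (measurable_funepos mf))//.
rewrite (ge0_integral_affine b a0 (measurable_funeneg mf))//.
(* [gt0_muleB] also covers the conventional value of [+oo - +oo], so the identity holds for
   integrals that do not converge. *)
by rewrite gt0_muleB// !unlock.
Qed.

Lemma integral_shift f b : measurable_fun [set: R] f ->
  (\int[mu]_x f (x + b)%R = \int[mu]_x f x)%E.
Proof.
move=> mf; rewrite (integral_affine b ltr01 mf) mul1e.
by under [RHS]eq_integral do rewrite /affine mul1r.
Qed.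

Lemma integral_scale f a : 0 < a -> measurable_fun [set: R] f ->
  (\int[mu]_x f x = a%:E * \int[mu]_x f (a * x)%R)%E.
Proof.
move=> a0 mf; rewrite (integral_affine 0 a0 mf).
by under eq_integral do rewrite /affine addr0.
Qed.

(** Folds the line at 0, a null point shared by both halves. Parts of [f] that are odd cancel inside
    the integrand on the right. *)
Lemma ge0_integral_reflect f :
  measurable_fun [set: R] f -> (forall x, (0 <= f x)%E) ->
  (\int[mu]_x f x = \int[mu]_(x in `[0%R, +oo[) (f x + f (- x)%R))%E.
Proof.
move=> mf f0.
have mfN : measurable_fun [set: R] (fun x => f (- x)).
  exact: (measurableT_comp mf (@oppr_measurable R setT)).
rewrite ge0_integralD//; last 2 first.
- exact: measurable_funS mf.
- exact: measurable_funS mfN.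
rewrite (ge0_integration_by_substitution0 mfN)//.
under [X in (_ = _ + X)%E]eq_integral do rewrite opprK.
rewrite -(itv_setU_setT true (0 : R)) ge0_integral_setU//; last 2 first.
- by rewrite itv_setU_setT.
- by apply/disj_set2P; rewrite -setCitvl setICr.
rewrite addeC; congr (_ + _)%E; apply: integral_itv_bndo_bndc.
exact: measurable_funS mf.
Qed.
End affine_change_of_variable.

(** * Continuity of translation in L^2 *)

Section clip.
Context {R : realType}.
Implicit Types (M N x y : R).

Definition clip M x : R := Num.max (- M) (Num.min M x).

Lemma clip_le M x : 0 <= M -> `|clip M x| <= M.
Proof.
move=> M0; rewrite ler_norml /clip le_max lexx/= ge_max ge_min lexx/= andbT.
by rewrite lerNl (le_trans _ M0)// oppr_le0.
Qed.

Lemma clip_id M x : `|x| <= M -> clip M x = x.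
Proof. by rewrite ler_norml => /andP[? ?]; rewrite /clip min_r// max_r. Qed.

Lemma clip_contract M x y : `|clip M x - clip M y| <= `|x - y|.
Proof.
wlog xy : x y / y <= x.
  by move=> h; have [/h//|/ltW/h] := leP y x; rewrite distrC (distrC y).
rewrite [leRHS]ger0_norm ?subr_ge0// ler_norml /clip /Order.max /Order.min.
by do 4?case: ifPn; rewrite -?leNgt => *; apply/andP; split; lra.
Qed.

Lemma clip_between M x : 0 <= M -> 0 <= x * clip M x /\ clip M x ^+ 2 <= x *
  clip M x.
Proof.
move=> M0; rewrite /clip /Order.max /Order.min.
by do 2?case: ifPn; rewrite -?leNgt => *; split; nra.
Qed.

Lemma continuous_clip M : continuous (clip M).
Proof.
move=> x; apply: (@continuous_max R R (cst (- M)) (fun x => Num.min M x) x).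
  exact: cvg_cst.
by apply: (@continuous_min R R (cst M) id x); [exact: cvg_cst|exact: cvg_id].
Qed.

(** A continuous trapezoid: 1 on [[-N, N]], 0 outside [[-N-1, N+1]], affine in between. *)
Definition cutoff N x : R := clip 1 (Num.max 0 (N + 1 - `|x|)).

Lemma cutoff_ge0 N x : 0 <= cutoff N x.
Proof. by rewrite /cutoff /clip le_max le_min ler01 le_max lexx/= orbT. Qed.

Lemma cutoff_le1 N x : cutoff N x <= 1.
Proof. by rewrite /cutoff /clip ge_max ge_min lexx/= andbT; lra. Qed.

Lemma cutoff_in N x : `|x| <= N -> cutoff N x = 1.
Proof.
move=> xN; have h : 1 <= Num.max 0 (N + 1 - `|x|).
  by rewrite le_max; apply/orP; right; lra.
by rewrite /cutoff /clip min_l// max_r//; lra.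
Qed.

Lemma cutoff_out N x : N + 1 <= `|x| -> cutoff N x = 0.
Proof.
by move=> xN; rewrite /cutoff max_l ?subr_le0// clip_id ?normr0.
Qed.

Lemma continuous_cutoff N : continuous (cutoff N).
Proof.
move=> x; apply: (@continuous_comp _ _ _ (fun x => Num.max 0 (N + 1 - `|x|)));
  last exact: continuous_clip.
apply: (@continuous_max R R (cst 0) (fun x => N + 1 - `|x|) x);
  first exact: cvg_cst.
by apply: cvgB; [exact: cvg_cst|exact: norm_continuous].
Qed.

Definition cut N x y : R := cutoff N x * clip N y.

Lemma cut_le N x y : 0 <= N -> `|cut N x y| <= N.
Proof.
move=> N0; rewrite /cut normrM ger0_norm ?cutoff_ge0//.
by rewrite (le_trans _ (clip_le y N0))// ler_piMl// cutoff_le1.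
Qed.

Lemma cut_contract N x y z : `|cut N x y - cut N x z| <= `|y - z|.
Proof.
rewrite /cut -mulrBr normrM ger0_norm ?cutoff_ge0//.
by rewrite (le_trans _ (clip_contract N y z))// ler_piMl// cutoff_le1.
Qed.

(** [cut N x y] lies between 0 and [y]. This is the domination behind [cvg_sqr_sub_cut]. *)
Lemma cut_sqr N x y : 0 <= N -> (y - cut N x y) ^+ 2 <= y ^+ 2.
Proof.
move=> N0; have [? ?] := clip_between y N0; rewrite /cut.
have := cutoff_ge0 N x; have := cutoff_le1 N x; nra.
Qed.

End clip.

Section ereal_cvg0.
Context {R : realType}.
Implicit Types (u : nat -> \bar R) (e : R).

Lemma cvge0_lt u e : u n @[n --> \oo] --> 0%E -> 0 < e ->
  \forall n \near \oo, (u n < e%:E)%E.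
Proof.
move=> /fine_cvgP[fu /cvgrPdist_lt uc] e0.
have := uc e e0; apply: filterS2 fu => n fn /=.
by rewrite sub0r normrN => /(le_lt_trans (ler_norm _)); rewrite -lte_fin fineK.
Qed.

Lemma cvge0_le u : (forall n, (0 <= u n)%E) ->
  (forall e, 0 < e -> \forall n \near \oo, (u n <= e%:E)%E) ->
  u n @[n --> \oo] --> 0%E.
Proof.
move=> u0 uc; apply/fine_cvgP; split.
  apply: filterS (uc 1 ltr01) => n un1; rewrite ge0_fin_numE//.
  exact: le_lt_trans un1 (ltry _).
apply/cvgrPdist_le => e e0; apply: filterS (uc e e0) => n une /=.
rewrite sub0r normrN ger0_norm ?fine_ge0// -lee_fin fineK//.
by rewrite ge0_fin_numE// (le_lt_trans une)// ltry.
Qed.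

End ereal_cvg0.

Lemma ge0_integrable d (T : measurableType d) (R : realType)
    (mu : {measure set T -> \bar R}) (f : T -> \bar R) :
  measurable_fun [set: T] f -> (forall x, (0 <= f x)%E) ->
  (\int[mu]_x f x < +oo)%E -> mu.-integrable setT f.
Proof.
move=> mf f0 foo; apply/integrableP; split=> //.
by under eq_integral do rewrite gee0_abs//.
Qed.

Section translation_continuity.
Context {R : realType}.
Notation mu := (@lebesgue_measure R).
Implicit Types (f g h : R -> R).

Lemma measurable_sqrE h : measurable_fun [set: R] h ->
  measurable_fun [set: R] (fun x => (h x ^+ 2)%:E).
Proof. by move=> mh; apply/measurable_EFinP; exact: measurable_funX. Qed.

Lemma measurable_cut N h : measurable_fun [set: R] h ->
  measurable_fun [set: R] (fun x => cut N x (h x)).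
Proof.
move=> mh; apply: measurable_funM.
  by apply: continuous_measurable_fun; exact: continuous_cutoff.
apply: (measurableT_comp _ mh); apply: continuous_measurable_fun.
exact: continuous_clip.
Qed.

Lemma integrable_sqr h : measurable_fun [set: R] h ->
  (\int[mu]_x (h x ^+ 2)%:E < +oo)%E ->
  mu.-integrable setT (fun x => (h x ^+ 2)%:E).
Proof.
move=> mh h2; apply: ge0_integrable => //; first exact: measurable_sqrE.
by move=> x; rewrite lee_fin sqr_ge0.
Qed.

Lemma cvg_sqr_sub_cut h : measurable_fun [set: R] h ->
  (\int[mu]_x (h x ^+ 2)%:E < +oo)%E ->
  (\int[mu]_x ((h x - cut n%:R x (h x)) ^+ 2)%:E)%E @[n --> \oo] --> 0%E.
Proof.
move=> mh h2.
have -> : 0%E = (\int[mu]_x (cst 0 x : \bar R))%E by rewrite integral0.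
apply: (@dominated_cvg _ _ _ mu setT measurableT _ _ (fun x =>
  (h x ^+ 2)%:E)) => //.
- move=> n; apply: measurable_sqrE; apply: measurable_funB => //.
  exact: measurable_cut.
- move=> x _; apply: cvg_near_cst.
  apply: filterS2 (nbhs_infty_ger `|x|) (nbhs_infty_ger `|h x|) => n xn hn.
  by rewrite /cut cutoff_in// clip_id// mul1r subrr expr0n.
- exact: integrable_sqr.
- move=> n x _; rewrite /= ger0_norm ?sqr_ge0// lee_fin.
  by apply: cut_sqr.
Qed.

(** [approximation_continuous_integrable] is an L^1 statement on a set of finite measure. It becomes
    an L^2 statement after truncation: for two functions bounded by [n], the square of the
    difference is at most [2 n] times its modulus. Applying the same [cut] to the approximant makes
    it bounded and compactly supported without increasing the distance. *)
Lemma L2_approximation h (e : R) : measurable_fun [set: R] h ->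
  (\int[mu]_x (h x ^+ 2)%:E < +oo)%E -> 0 < e ->
  exists g N, [/\ continuous g, 0 <= N, forall x, `|g x| <= N,
    forall x, N + 1 <= `|x| -> g x = 0 &
    (\int[mu]_x ((h x - g x) ^+ 2)%:E <= e%:E)%E].
Proof.
move=> mh h2 e0.
have e4 : 0 < e / 4 by rewrite divr_gt0.
have [n _ /(_ n (leqnn n)) /= hn] := cvge0_lt (cvg_sqr_sub_cut mh h2) e4.
set u := fun x => h x - cut n%:R x (h x) in hn.
have n0 : 0 <= n%:R :> R by [].
pose E : set R := `[- (n%:R + 1), n%:R + 1]%classic.
have mE : measurable E by exact: measurable_itv.
have muE : (mu E < +oo)%E.
  by rewrite /E lebesgue_measure_itv; case: ifPn; rewrite ?ltry// -EFinD ltry.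
pose c x := clip n%:R (h x).
have mc : measurable_fun [set: R] c.
  apply: (measurableT_comp _ mh); apply: continuous_measurable_fun.
  exact: continuous_clip.
have ic : mu.-integrable E (EFin \o c).
  apply: measurable_bounded_integrable => //; first exact: measurable_funS mc.
  exists n%:R; split; first by rewrite num_real.
  by move=> M nM x _; apply: le_trans (ltW nM); exact: clip_le.
have [g_ [cg ig gc]] := approximation_continuous_integrable mE muE ic.
(* The factor [4 n] in [key] turns this into at most [e / 2]; the other half is twice the [e / 4]
   above. The denominator has [n + 1] because [n] may be 0. *)
have d0 : 0 < e / (8 * (n%:R + 1)) by rewrite divr_gt0// mulr_gt0// ltr_wpDl.
have [k _ /(_ k (leqnn k)) /= gk] := cvge0_lt gc d0.
exists (fun x => cut n%:R x (g_ k x)), n%:R; split => //.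
- move=> x; apply: cvgM; first exact: continuous_cutoff.
  by apply: continuous_comp; [exact: cg|exact: continuous_clip].
- by move=> x; exact: cut_le.
- by move=> x nx; rewrite /cut cutoff_out// mul0r.
have mg : measurable_fun [set: R] (g_ k) by exact: continuous_measurable_fun.
have mu_ : measurable_fun [set: R] u.
  by apply: measurable_funB => //; exact: measurable_cut.
have mcg : measurable_fun [set: R] (fun x => `|c x - g_ k x|).
  apply: measurableT_comp => //; exact: measurable_funB.
have key x : (h x - cut n%:R x (g_ k x)) ^+ 2 <=
    2 * u x ^+ 2 + 4 * n%:R * (`|c x - g_ k x| * \1_E x).
  pose a := cut n%:R x (h x) - cut n%:R x (g_ k x).
  have -> : h x - cut n%:R x (g_ k x) = u x + a.
    by rewrite /u /a addrA subrK.
  have a2 : a ^+ 2 <= 2 * n%:R * (`|c x - g_ k x| * \1_E x).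
    rewrite -real_normK ?num_real// expr2.
    have a2n : `|a| <= 2 * n%:R.
      rewrite (le_trans (ler_normB _ _))// mulrDl mul1r.
      by apply: lerD; exact: cut_le.
    apply: ler_pM => //.
    have [xE|xE] := pselect (E x).
      rewrite indicE mem_set// mulr1.
      have -> : a = cut n%:R x (c x) - cut n%:R x (g_ k x).
        by rewrite /a /cut /c (@clip_id _ _ (clip _ _)) ?clip_le.
      exact: cut_contract.
    rewrite indicE memNset// mulr0 /a /cut cutoff_out ?mul0r ?subrr ?normr0//.
    rewrite leNgt; apply/negP => /ltW; rewrite ler_norml => xn; apply: xE.
    by rewrite /E/= in_itv.
  have := sqr_ge0 (u x - a); nra.
apply: (@le_trans _ _ (\int[mu]_x (2 * u x ^+ 2 +
  4 * n%:R * (`|c x - g_ k x| * \1_E x))%:E)%E).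
  apply: ge0_le_integral => //.
  - by move=> x _; rewrite lee_fin sqr_ge0.
  - by apply: measurable_sqrE; apply: measurable_funB => //;
      exact: measurable_cut.
  - apply/measurable_EFinP; apply: measurable_funD.
      by apply: measurable_funM => //; exact: measurable_funX.
    by apply: measurable_funM => //; apply: measurable_funM => //.
  - by move=> x _; rewrite lee_fin.
under eq_integral do rewrite EFinD (EFinM 2) (EFinM (4 * n%:R)).
rewrite ge0_integralD//; last 3 first.
- by move=> x _; rewrite -EFinM lee_fin mulr_ge0// sqr_ge0.
- apply/measurable_EFinP; apply: measurable_funM => //; exact: measurable_funX.
- by apply/measurable_EFinP; apply: measurable_funM => //;
    apply: measurable_funM => //.
rewrite ge0_integralZl_EFin//; last 2 first.
- by move=> x _; rewrite lee_fin sqr_ge0.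
- exact: measurable_sqrE.
rewrite ge0_integralZl_EFin ?mulr_ge0//; last first.
  by apply/measurable_EFinP; apply: measurable_funM.
have -> : (\int[mu]_x (`|c x - g_ k x| * \1_E x)%:E =
  \int[mu]_(x in E) `|(c x - g_ k x)%:E|)%E.
  rewrite [RHS]integral_mkcond; apply: eq_integral => x _.
  rewrite patchE indicE; case: ifPn => _; by rewrite ?mulr1 ?mulr0.
apply: (@le_trans _ _ (2%:E * (e / 4)%:E + (4 * n%:R)%:E * (e / (8 * (n%:R +
  1)))%:E)%E).
  by apply: leeD; apply: lee_wpmul2l; rewrite ?lee_fin ?mulr_ge0// ltW.
rewrite -!EFinM -EFinD lee_fin.
have n1 : 0 < n%:R + 1 :> R by rewrite ltr_wpDl.
have -> : 4 * n%:R * (e / (8 * (n%:R + 1))) = (e / 2) * (n%:R / (n%:R + 1)).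
  by field; rewrite gt_eqF.
have : n%:R / (n%:R + 1) <= 1 :> R by rewrite ler_pdivrMr// mul1r lerDl.
by move=> ?; nra.
Qed.

End translation_continuity.

Section translation_modulus.
Context {R : realType}.
Notation mu := (@lebesgue_measure R).
Implicit Types (f g h : R -> R) (t : R).

Lemma measurable_shift h t : measurable_fun [set: R] h ->
  measurable_fun [set: R] (fun x => h (x + t)).
Proof.
by move=> mh; apply: (measurableT_comp mh); exact: measurable_funD.
Qed.

Lemma integrable_shift (f : R -> \bar R) t : mu.-integrable setT f ->
  mu.-integrable setT (fun x => f (x + t)).
Proof.
move=> /integrableP[mf foo]; apply/integrableP; split.
  by apply: (measurableT_comp mf); exact: measurable_funD.
by rewrite (integral_shift t (f := fun x => `|f x|%E))//;
  exact: measurableT_comp.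
Qed.

Definition tmod h t := (\int[mu]_x ((h x - h (x + t)) ^+ 2)%:E)%E.

Lemma tmod_ge0 h t : (0 <= tmod h t)%E.
Proof. by apply: integral_ge0 => x _; rewrite lee_fin sqr_ge0. Qed.

Lemma cvg_tmod_continuous g N T (t_ : nat -> R) : continuous g -> 0 <= N ->
  (forall x, `|g x| <= N) -> (forall x, N + 1 <= `|x| -> g x = 0) ->
  t_ n @[n --> \oo] --> 0 -> (forall n, `|t_ n| <= T) ->
  tmod g (t_ n) @[n --> \oo] --> 0%E.
Proof.
move=> cg N0 gN gout t0 tT.
have mg : measurable_fun [set: R] g by exact: continuous_measurable_fun.
have T0 : 0 <= T by exact: le_trans (tT 0%N).
(* Contains the support of [g] and of all its translates by at most [T], so one integrable majorant
   serves every [n]. *)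
pose E : set R := `[- (N + 1 + T), N + 1 + T]%classic.
have -> : 0%E = (\int[mu]_x (cst 0 x : \bar R))%E by rewrite integral0.
apply: (@dominated_cvg _ _ _ mu setT measurableT _ _
  (fun x => (4 * N ^+ 2)%:E * (\1_E x)%:E)%E) => //.
- move=> n; apply: measurable_sqrE; apply: measurable_funB => //.
  exact: measurable_shift.
- move=> x _.
  have -> : cst 0%E x = ((g x - g (x + 0)) ^+ 2)%:E by rewrite addr0 subrr
    expr0n.
  apply: cvg_EFin; first by near=> n.
  rewrite expr2; under eq_cvg do rewrite /= expr2.
  have gc : g x - g (x + t_ n) @[n --> \oo] --> g x - g (x + 0).
    apply: cvgB; first exact: cvg_cst.
    apply: continuous_cvg; first exact: cg.
    by apply: cvgD => //; exact: cvg_cst.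
  exact: cvgM.
- apply: integrableZl => //.
  exact: integrable_indic_itv.
- move=> n x _; rewrite /= ger0_norm ?sqr_ge0// -EFinM lee_fin.
  have [xE|xE] := pselect (E x).
    rewrite indicE mem_set// mulr1 -real_normK ?num_real//.
    have -> : 4 * N ^+ 2 = (N + N) ^+ 2 by ring.
    rewrite lerXn2r ?nnegrE ?addr_ge0// (le_trans (ler_normB _ _))//.
    exact: lerD.
  rewrite indicE memNset// mulr0.
  have xN : N + 1 + T <= `|x|.
    rewrite leNgt; apply/negP => /ltW; rewrite ler_norml => xn; apply: xE.
    by rewrite /E/= in_itv.
  rewrite !gout ?subrr ?expr0n//.
    by have := tT n; have := lerB_normD x (t_ n); lra.
  by have := normr_ge0 x; lra.
Unshelve. all: by end_near.
Qed.

Lemma cvg_tmod h T (t_ : nat -> R) : measurable_fun [set: R] h ->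
  (\int[mu]_x (h x ^+ 2)%:E < +oo)%E ->
  t_ n @[n --> \oo] --> 0 -> (forall n, `|t_ n| <= T) ->
  tmod h (t_ n) @[n --> \oo] --> 0%E.
Proof.
move=> mh h2 t0 tT; apply: cvge0_le => [n|e e0]; first exact: tmod_ge0.
(* The difference is split as [(h - g) + (g - g_t) + (g_t - h_t)]. The square of a sum of three
   terms costs a factor 3, and each of the three integrals is at most [e / 9], the outer two being
   equal by translation invariance. *)
have e9 : 0 < e / 9 by rewrite divr_gt0.
have [g [N [cg N0 gN gout hg]]] := L2_approximation mh h2 e9.
have mg : measurable_fun [set: R] g by exact: continuous_measurable_fun.
apply: filterS (cvge0_lt (cvg_tmod_continuous cg N0 gN gout t0 tT) e9) => n gn.
pose d x := (h x - g x) ^+ 2.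
have md : measurable_fun [set: R] (EFin \o d).
  by apply: measurable_sqrE; exact: measurable_funB.
pose q x := (g x - g (x + t_ n)) ^+ 2.
have mq : measurable_fun [set: R] (EFin \o q).
  apply: measurable_sqrE; apply: measurable_funB => //; exact: measurable_shift.
apply: (@le_trans _ _ (\int[mu]_x (3%:E * ((EFin \o d) x + ((EFin \o d) (x +
  t_ n)%R + (EFin \o q) x))))%E).
  apply: ge0_le_integral => //.
  - by move=> x _; rewrite lee_fin sqr_ge0.
  - apply: measurable_sqrE; apply: measurable_funB => //;
      exact: measurable_shift.
  - apply: measurable_funeM; apply: emeasurable_funD => //.
    apply: emeasurable_funD => //; apply: (measurableT_comp md).
    exact: measurable_funD.
  - move=> x _; rewrite /= -!EFinD -EFinM lee_fin /d /q.
    set a := h x; set b := h _; set c := g x; set k := g _.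
    (* The squared pairwise differences of the three terms add up exactly to the gap in
       [(x + y + z)^2 <= 3 (x^2 + y^2 + z^2)]. *)
    have := sqr_ge0 ((a - c) + (b - k)); have := sqr_ge0 ((a - c) - (c - k)).
    have := sqr_ge0 ((c - k) + (b - k)); nra.
have mds : measurable_fun [set: R] (fun x => (EFin \o d) (x + t_ n)).
  by apply: (measurableT_comp md); exact: measurable_funD.
rewrite ge0_integralZl_EFin//; last 2 first.
- by move=> x _; rewrite /= -!EFinD lee_fin !addr_ge0 ?sqr_ge0.
- by apply: emeasurable_funD => //; exact: emeasurable_funD.
rewrite ge0_integralD//; last 3 first.
- by move=> x _; rewrite lee_fin sqr_ge0.
- by move=> x _; rewrite /= -!EFinD lee_fin !addr_ge0 ?sqr_ge0.
- exact: emeasurable_funD.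
rewrite ge0_integralD//; last 2 first.
- by move=> x _; rewrite lee_fin sqr_ge0.
- by move=> x _; rewrite lee_fin sqr_ge0.
rewrite integral_shift//.
apply: (@le_trans _ _ (3%:E * ((e / 9)%:E + ((e / 9)%:E + (e / 9)%:E)))%E).
  apply: lee_wpmul2l; rewrite ?lee_fin//.
  by apply: leeD => //; apply: leeD => //; exact: ltW.
rewrite -!EFinD -EFinM lee_fin; lra.
Qed.

End translation_modulus.

(** * Autocorrelation *)

Section integrable_EFin.
Context d (T : measurableType d) (R : realType) (mu : {measure set T ->
  \bar R}).
Implicit Types (f g : T -> R) (D : set T).

Lemma integrable_EFinD D f g : measurable D -> mu.-integrable D (EFin \o f) ->
  mu.-integrable D (EFin \o g) -> mu.-integrable D (EFin \o (fun x =>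
    f x + g x)).
Proof. by move=> mD fi gi; apply: eq_integrable (integrableD mD fi gi). Qed.

Lemma integrable_EFinB D f g : measurable D -> mu.-integrable D (EFin \o f) ->
  mu.-integrable D (EFin \o g) -> mu.-integrable D (EFin \o (fun x =>
    f x - g x)).
Proof. by move=> mD fi gi; apply: eq_integrable (integrableB mD fi gi). Qed.

Lemma integrable_EFinZl D k f : measurable D -> mu.-integrable D (EFin \o f) ->
  mu.-integrable D (EFin \o (fun x => k * f x)).
Proof. by move=> mD fi; apply: eq_integrable (integrableZl mD k fi). Qed.

End integrable_EFin.

Section parametric_integral.
Context d1 d2 (T1 : measurableType d1) (T2 : measurableType d2) (R : realType)
  (m2 : {sigma_finite_measure set T2 -> \bar R}).

(** Tonelli gives measurability for the positive and the negative part, and the extended difference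
    of measurable functions is measurable even where both are infinite. *)
Lemma measurable_fun_param_integral (k : T1 * T2 -> \bar R) :
  measurable_fun [set: T1 * T2] k ->
  measurable_fun [set: T1] (fun x => \int[m2]_y k (x, y))%E.
Proof.
move=> mk.
have -> : (fun x => \int[m2]_y k (x, y))%E =
    (fun x => \int[m2]_y k^\+ (x, y) - \int[m2]_y k^\- (x, y))%E.
  apply/funext => x; rewrite integralE; congr (_ - _)%E.
    by apply: eq_integral => y _; rewrite !unlock.
  by apply: eq_integral => y _; rewrite !unlock.
apply: emeasurable_funB.
- apply: measurable_fun_fubini_tonelli_F => //; exact: measurable_funepos.
- apply: measurable_fun_fubini_tonelli_F => //; exact: measurable_funeneg.
Qed.

Lemma measurable_fun_param_Rintegral (k : T1 * T2 -> R) :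
  measurable_fun [set: T1 * T2] k ->
  measurable_fun [set: T1] (fun x => \int[m2]_y k (x, y)).
Proof.
move=> mk; apply: measurableT_comp => //.
by apply: (@measurable_fun_param_integral (EFin \o k)); exact/measurable_EFinP.
Qed.

End parametric_integral.

Section autocorrelation_limit.
Context {R : realType}.
Notation mu := (@lebesgue_measure R).
Implicit Types (h : R -> R) (t : R).

Definition sqn h : R := \int[mu]_x (h x ^+ 2).
Definition autocorr h t : R := \int[mu]_x (h x * h (x + t)).

Section square_integrable.
Context h (mh : measurable_fun [set: R] h)
  (h2 : (\int[mu]_x (h x ^+ 2)%:E < +oo)%E).

Lemma integrable_sqr_shift t :
  mu.-integrable setT (EFin \o (fun x => h (x + t) ^+ 2)).
Proof. exact: integrable_shift (integrable_sqr mh h2). Qed.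

Lemma sqn_shift t : \int[mu]_x (h (x + t) ^+ 2) = sqn h.
Proof.
by rewrite /sqn /Rintegral (integral_shift t (measurable_sqrE mh)).
Qed.

Lemma integrable_autocorr t :
  mu.-integrable setT (EFin \o (fun x => h x * h (x + t))).
Proof.
have i1 := integrable_sqr mh h2; have i2 := integrable_sqr_shift t.
apply: le_integrable (integrableD measurableT i1 i2) => //.
  by apply/measurable_EFinP; apply: measurable_funM => //;
    exact: measurable_shift.
move=> x _; rewrite /= -?EFinD lee_fin.
rewrite (ger0_norm (addr_ge0 (sqr_ge0 _) (sqr_ge0 _))) ler_norml.
have := sqr_ge0 (h x + h (x + t)); have := sqr_ge0 (h x - h (x + t)).
have := sqr_ge0 (h x); have := sqr_ge0 (h (x + t)).
by move=> *; apply/andP; split; nra.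
Qed.

(** Expanding the square in [tmod] and using translation invariance reduces continuity of the
    autocorrelation at 0 to continuity of translation in L^2. *)
Lemma autocorrE t : autocorr h t = sqn h - fine (tmod h t) / 2.
Proof.
have i1 := integrable_sqr mh h2; have i2 := integrable_sqr_shift t.
have i4 := integrable_autocorr t; have i3 := integrable_EFinZl 2 measurableT i4.
rewrite /tmod -/(Rintegral _ _ _).
have -> : \int[mu]_x (h x - h (x + t)) ^+ 2 = 2 * sqn h - 2 * autocorr h t.
  transitivity (\int[mu]_x (h x ^+ 2 + h (x + t) ^+ 2 - 2 * (h x * h (x + t)))).
    by apply: eq_Rintegral => x _; ring.
  rewrite RintegralB//; last exact: integrable_EFinD.
  rewrite RintegralD// sqn_shift RintegralZl// /sqn /autocorr; ring.
by field.
Qed.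

(** [|x y| <= (x^2 + y^2) / 2] takes the place of Cauchy-Schwarz, since both squares have the same
    integral. *)
Lemma autocorr_le t : `|autocorr h t| <= sqn h.
Proof.
have i1 := integrable_sqr mh h2; have i2 := integrable_sqr_shift t.
apply: le_trans (le_normr_Rintegral _ (integrable_autocorr t)) _ => //.
have -> : sqn h = \int[mu]_x (2^-1 * (h x ^+ 2 + h (x + t) ^+ 2)).
  rewrite RintegralZl//; last exact: integrable_EFinD.
  by rewrite RintegralD// sqn_shift -/(sqn h); field.
apply: le_Rintegral => //.
- exact: integrable_norm (integrable_autocorr t).
- by apply: integrable_EFinZl => //; exact: integrable_EFinD.
- move=> x _; rewrite ler_norml.
  have := sqr_ge0 (h x + h (x + t)); have := sqr_ge0 (h x - h (x + t)).
  by move=> *; apply/andP; split; nra.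
Qed.

Lemma cvg_autocorr T (t_ : nat -> R) :
  t_ n @[n --> \oo] --> 0 -> (forall n, `|t_ n| <= T) ->
  autocorr h (t_ n) @[n --> \oo] --> sqn h.
Proof.
move=> t0 tT.
have : sqn h - fine (tmod h (t_ n)) / 2 @[n --> \oo] --> sqn h - 0 / 2.
  apply: cvgB; first exact: cvg_cst.
  apply: cvgM; last exact: cvg_cst.
  by have /fine_cvgP[_] := cvg_tmod mh h2 t0 tT.
by rewrite mul0r subr0; under eq_cvg do rewrite -autocorrE.
Qed.

Lemma measurable_autocorr : measurable_fun [set: R] (autocorr h).
Proof.
pose k (p : R * R) := h p.2 * h (p.2 + p.1).
apply: (@measurable_fun_param_Rintegral _ _ _ _ R mu k).
apply: measurable_funM; first exact: measurableT_comp.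
apply: (measurableT_comp mh); exact: measurable_funD.
Qed.

End square_integrable.
End autocorrelation_limit.

(** * The Laplace transform of the cosine *)

Section laplace_cos.
Context {R : realType}.
Notation mu := (@lebesgue_measure R).
Implicit Types (c t u : R).

(* [1 + cos] instead of [cos] makes the integrand nonnegative, as the improper
   fundamental theorem of calculus of the library requires. *)
Let f c t u : R := expR (- (c * u)) * (1 + cos (t * u)).
(** The antiderivative of [f] that vanishes at infinity, so that the integral over the half line is
    [- F c t 0]; the term [- c^-1] accounts for the summand 1. *)
Let F c t u : R := expR (- (c * u)) *
  ((c ^+ 2 + t ^+ 2)^-1 * (t * sin (t * u) - c * cos (t * u)) - c^-1).

Let is_derive_lin a u : is_derive u 1 (fun x : R => a * x) a.
Proof.
have := is_deriveM (is_derive_cst a u 1) (is_derive_id u (1 : R)).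
by move=> h; apply: is_derive_eq h _; rewrite scaler0 addr0 /GRing.scale/=
  mulr1.
Qed.

Let is_derive_F c t u : 0 < c -> is_derive u 1 (F c t) (f c t u).
Proof.
move=> c0.
have De : is_derive u 1 (fun x => expR (- (c * x))) (expR (- (c * u)) * - c).
  apply: (is_derive1_comp (f := expR) (g := fun x => - (c * x))).
  exact: is_deriveN (is_derive_lin c u).
have Ds : is_derive u 1 (fun x => sin (t * x)) (cos (t * u) * t).
  exact: (is_derive1_comp (f := sin) (is_derive_sin _) (is_derive_lin t u)).
have Dc : is_derive u 1 (fun x => cos (t * x)) (- sin (t * u) * t).
  exact: (is_derive1_comp (f := cos) (is_derive_cos _) (is_derive_lin t u)).
have D1 := is_deriveB (is_deriveM (is_derive_cst t u 1) Ds)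
  (is_deriveM (is_derive_cst c u 1) Dc).
have D2 := is_deriveB (is_deriveM (is_derive_cst ((c ^+ 2 + t ^+ 2)^-1) u 1) D1)
  (is_derive_cst (c^-1) u 1).
have D3 := is_deriveM De D2.
apply: is_derive_eq D3 _; rewrite /f /GRing.scale/=.
rewrite !fctE/=; field.
by apply/andP; split; rewrite gt_eqF// ltr_pwDl ?exprn_gt0// sqr_ge0.
Qed.

Let continuous_f c t : continuous (f c t).
Proof.
move=> u; apply: cvgM.
  apply: continuous_comp; last exact: continuous_expR.
  by apply: cvgN; apply: cvgM; [exact: cvg_cst|exact: cvg_id].
apply: cvgD; first exact: cvg_cst.
apply: continuous_comp; last exact: continuous_cos.
by apply: cvgM; [exact: cvg_cst|exact: cvg_id].
Qed.

Let f_ge0 c t u : 0 <= f c t u.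
Proof. by rewrite mulr_ge0 ?expR_ge0// -lerBlDl sub0r cos_geN1. Qed.

Let cvgy_F c t : 0 < c -> F c t u @[u --> +oo] --> 0.
Proof.
move=> c0; pose M := (c ^+ 2 + t ^+ 2)^-1 * (`|t| + c) + c^-1.
have k0 : 0 <= (c ^+ 2 + t ^+ 2)^-1 by rewrite invr_ge0 addr_ge0 ?sqr_ge0.
have Ec : expR (- (c * u)) @[u --> +oo] --> 0.
  apply: (@cvg_comp _ _ _ (fun u => c * u) (fun u => expR (- u)) _ +oo);
    last exact: cvgr_expR.
  by apply: gt0_cvgMry; [|exact: cvg_id].
have FM u : `|F c t u| <= M * expR (- (c * u)).
  rewrite /F normrM (ger0_norm (expR_ge0 _)) mulrC ler_wpM2r ?expR_ge0//.
  have ci : `|c^-1| = c^-1 by rewrite gtr0_norm ?invr_gt0.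
  rewrite (le_trans (ler_normB _ _))// /M ci lerD2r.
  rewrite normrM (ger0_norm k0) ler_wpM2l// (le_trans (ler_normB _ _))//.
  apply: lerD; rewrite normrM.
    by rewrite ler_piMr// ler_norml sin_geN1 sin_le1.
  by rewrite (gtr0_norm c0) ler_piMr ?(ltW c0)// ler_norml cos_geN1 cos_le1.
apply: (@squeeze_cvgr _ _ _ _ (fun u => - (M * expR (- (c * u)))) (fun u =>
  M * expR (- (c * u)))).
- by near=> u; rewrite -ler_norml.
- rewrite -oppr0 -(mulr0 M); apply: cvgN; apply: cvgM => //; exact: cvg_cst.
- rewrite -(mulr0 M); apply: cvgM => //; exact: cvg_cst.
Unshelve. all: by end_near.
Qed.

Let integral_f c t : 0 < c ->
  (\int[mu]_(u in `[0%R, +oo[) (f c t u)%:E = (c^-1 + c / (c ^+ 2 +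
    t ^+ 2))%:E)%E.
Proof.
move=> c0; rewrite (ge0_continuous_FTC2y (F := F c t) (l := 0)).
- rewrite -EFinB; congr EFin.
  rewrite /F !mulr0 oppr0 expR0 sin0 cos0; field.
  by apply/andP; split; rewrite gt_eqF// ltr_pwDl ?exprn_gt0// sqr_ge0.
- by move=> u _; exact: f_ge0.
- by apply: continuous_subspaceT; exact: continuous_f.
- exact: cvgy_F.
- by move=> u _; have [] := is_derive_F t u c0.
- apply: cvg_at_right_filter; apply: differentiable_continuous.
  by apply/derivable1_diffP; have [] := is_derive_F t 0 c0.
- by move=> u _; rewrite derive1E; have [_ ->] := is_derive_F t u c0.
Qed.

(** The half line is encoded as an indicator, so that Fubini can be used on the whole plane. At
    [t = 0] this is the damping weight itself, which also dominates all other [t]. *)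
Definition expcos c t u : R := \1_(`[0, +oo[%classic : set R) u * (expR (- (c *
  u)) * cos (t * u)).

Lemma measurable_expcos c : measurable_fun [set: R * R] (fun p =>
  expcos c p.1 p.2).
Proof.
apply: measurable_funM.
  apply: measurableT_comp; last exact: measurable_snd.
  exact: measurable_indic.
apply: measurable_funM.
  apply: measurableT_comp => //; apply: measurableT_comp => //.
  by apply: measurable_funM.
apply: measurableT_comp.
  by apply: continuous_measurable_fun; exact: continuous_cos.
by apply: measurable_funM.
Qed.

Let measurable_expcos_slice c t : measurable_fun [set: R] (expcos c t).
Proof.
by have := measurableT_comp (measurable_expcos c) (@pair1_measurable _ _ R R t).
Qed.

Lemma normr_expcos c t u : `|expcos c t u| <= expcos c 0 u.
Proof.
rewrite /expcos mul0r cos0 mulr1 !normrM (ger0_norm (expR_ge0 _)).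
rewrite indicE ger0_norm ?ler0n// ler_wpM2l ?ler0n//.
by rewrite ler_piMr ?expR_ge0// ler_norml cos_geN1 cos_le1.
Qed.

Let integral_expcos0 c : 0 < c -> (\int[mu]_u (expcos c 0 u)%:E = c^-1%:E)%E.
Proof.
move=> c0.
(* At [t = 0] the integrand with [1 + cos] is twice the exponential. *)
have : (\int[mu]_u (2%:E * (expcos c 0 u)%:E) = 2%:E * (c^-1)%:E)%E.
  rewrite -EFinM (_ : 2 * c^-1 = c^-1 + c / (c ^+ 2 + 0 ^+ 2)); last first.
    by field; rewrite gt_eqF.
  rewrite -integral_f// [RHS]integral_mkcond; apply: eq_integral => u _.
  rewrite patchE /expcos /f indicE mul0r cos0.
  by case: ifPn => _; rewrite -EFinM ?mul1r ?mul0r ?mulr0//; congr EFin; ring.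
rewrite ge0_integralZl_EFin//; last 2 first.
- by move=> u _; rewrite lee_fin; exact: le_trans (normr_expcos c 0 u).
- by apply/measurable_EFinP; exact: measurable_expcos_slice.
move=> /(congr1 (fun x => 2^-1%:E * x)%E).
by rewrite !muleA -!EFinM mulVf// mul1e mul1r.
Qed.

Lemma integrable_expcos c t : 0 < c -> mu.-integrable setT (EFin \o expcos c t).
Proof.
move=> c0.
have mt s : measurable_fun [set: R] (EFin \o expcos c s).
  by apply/measurable_EFinP; exact: measurable_expcos_slice.
have i0 : mu.-integrable setT (EFin \o expcos c 0).
  apply: ge0_integrable => //; first exact: mt.
    by move=> u; rewrite lee_fin; exact: le_trans (normr_expcos c 0 u).
  by rewrite integral_expcos0// ltry.
apply: le_integrable i0 => //; first exact: mt.
move=> u _ /=; by rewrite lee_fin (le_trans (normr_expcos c t u))// ler_norm.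
Qed.

Lemma Rintegral_expcos c t : 0 < c -> \int[mu]_u expcos c t u =
  c / (c ^+ 2 + t ^+ 2).
Proof.
move=> c0; have i0 := integrable_expcos 0 c0; have it := integrable_expcos t c0.
(* Adding the integral of [expcos c 0], which is [1 / c], restores the integrand with [1 + cos]
   computed in [integral_f]. *)
apply: (@addrI _ (\int[mu]_u expcos c 0 u)); rewrite -RintegralD//.
rewrite {2}/Rintegral integral_expcos0//=.
rewrite -[RHS]/(fine (_%:E)) -integral_f// [in RHS]integral_mkcond.
congr fine; apply: eq_integral => u _.
rewrite patchE /expcos /f indicE mul0r cos0.
by case: ifPn => _; rewrite ?mul1r ?mul0r ?addr0//; congr EFin; ring.
Qed.

End laplace_cos.

(** * Iterated real integrals *)

Section Rintegral_fubini.
Context d1 d2 (T1 : measurableType d1) (T2 : measurableType d2) (R : realType)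
  (m1 : {sigma_finite_measure set T1 -> \bar R})
  (m2 : {sigma_finite_measure set T2 -> \bar R}).

Lemma le_abse_fine (x : \bar R) : (`|(fine x)%:E| <= `|x|)%E.
Proof. by case: x => [x||] //=; rewrite normr0 ?leey. Qed.

Section product_integrable.
Context (k : T1 * T2 -> R)
  (ik : (m1 \x m2)%E.-integrable setT (EFin \o k)).

Let mk : measurable_fun setT k.
Proof. by apply/measurable_EFinP; exact: measurable_int ik. Qed.

Lemma integrable_marginal1 :
  m1.-integrable setT (EFin \o (fun x => \int[m2]_y k (x, y))).
Proof.
apply: le_integrable (integrable_fubini_F ik) => //.
  by apply/measurable_EFinP; exact: measurable_fun_param_Rintegral mk.
by move=> x _; exact: le_abse_fine.
Qed.

Let mkC : measurable_fun setT (fun p : T2 * T1 => k (p.2, p.1)).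
Proof. by apply: (measurableT_comp mk); exact: measurable_fun_pair. Qed.

Let ikC : (m2 \x m1)%E.-integrable setT (EFin \o (fun p : T2 * T1 =>
  k (p.2, p.1))).
Proof.
apply/integrable12ltyP; first exact/measurable_EFinP.
by move/integrable21ltyP : ik; apply; exact/measurable_EFinP.
Qed.

Lemma integrable_marginal2 :
  m2.-integrable setT (EFin \o (fun y => \int[m1]_x k (x, y))).
Proof.
apply: le_integrable (integrable_fubini_F ikC) => //.
  by apply/measurable_EFinP; exact: measurable_fun_param_Rintegral mkC.
by move=> x _; exact: le_abse_fine.
Qed.

(** The real inner integral replaces an infinite value by 0, but almost every slice is integrable,
    so this affects only a null set. *)
Lemma Rintegral_prod1 :
  \int[(m1 \x m2)%E]_z k z = \int[m1]_x \int[m2]_y k (x, y).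
Proof.
rewrite /Rintegral -(integral12_prod_meas1 ik); congr fine.
apply: ae_eq_integral => //.
- exact: measurable_fubini_F ik.
- exact: measurable_int integrable_marginal1.
apply: filterS (ae_integrable1 ik) => x ix _; rewrite /fubini_F/= fineK//.
exact: integrable_fin_num.
Qed.

Lemma Rintegral_prod2 :
  \int[(m1 \x m2)%E]_z k z = \int[m2]_y \int[m1]_x k (x, y).
Proof.
rewrite /Rintegral -(integral21_prod_meas1 ik); congr fine.
apply: ae_eq_integral => //.
- exact: measurable_fubini_G ik.
- exact: measurable_int integrable_marginal2.
apply: filterS (ae_integrable2 ik) => x ix _; rewrite /fubini_G/= fineK//.
exact: integrable_fin_num.
Qed.

Lemma Rintegral_swap :
  \int[m1]_x \int[m2]_y k (x, y) = \int[m2]_y \int[m1]_x k (x, y).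
Proof. by rewrite -Rintegral_prod1 Rintegral_prod2. Qed.

End product_integrable.

Lemma integrable_tensor (f : T1 -> R) (g : T2 -> R) :
  m1.-integrable setT (EFin \o f) -> m2.-integrable setT (EFin \o g) ->
  (m1 \x m2)%E.-integrable setT (EFin \o (fun z => f z.1 * g z.2)).
Proof.
move=> fi gi.
have mf : measurable_fun setT f by apply/measurable_EFinP;
  exact: measurable_int fi.
have mg : measurable_fun setT g by apply/measurable_EFinP;
  exact: measurable_int gi.
apply/integrable12ltyP.
  apply/measurable_EFinP; apply: measurable_funM; exact: measurableT_comp.
have [_ fy] := integrableP _ _ _ fi; have [_ gy] := integrableP _ _ _ gi.
have -> : (\int[m1]_x \int[m2]_y `|(EFin \o (fun z : T1 * T2 =>
  (f z.1 * g z.2)%R)) (x, y)| =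
    \int[m1]_x (`|(f x)%:E| * \int[m2]_y `|(g y)%:E|))%E.
  apply: eq_integral => x _; rewrite -ge0_integralZl//.
    by apply: eq_integral => y _; rewrite /= normrM EFinM.
  by apply/measurable_EFinP; exact: measurableT_comp.
rewrite ge0_integralZr//; last 2 first.
  by apply/measurable_EFinP; exact: measurableT_comp.
  exact: integral_ge0.
rewrite lte_mul_pinfty//; first exact: integral_ge0.
by rewrite ge0_fin_numE//; exact: integral_ge0.
Qed.

End Rintegral_fubini.

(** * The squared modulus as cosine transform of the autocorrelation *)

Section fourier_autocorrelation.
Context {R : realType}.
Notation mu := (@lebesgue_measure R).
Implicit Types (h : R -> R) (t u : R).

Lemma Rintegral_shift h b : measurable_fun [set: R] h ->
  \int[mu]_x h (x + b) = \int[mu]_x h x.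
Proof.
move=> mh; rewrite /Rintegral (integral_shift b (f := EFin \o h))//.
exact/measurable_EFinP.
Qed.

Lemma Rintegral_scale h c : 0 < c -> measurable_fun [set: R] h ->
  \int[mu]_x h x = c * \int[mu]_x h (c * x).
Proof.
move=> c0 mh; rewrite /Rintegral (integral_scale (f := EFin \o h) c0)//;
  last first.
  exact/measurable_EFinP.
(* An infinite integral stays infinite under the positive factor, and [fine] sends it to 0 on both
   sides. *)
by case: (integral _ _ _) => [r||] //=; rewrite ?gt0_muley ?gt0_muleNy
  ?lte_fin// mulr0.
Qed.

Lemma measurable_cos : measurable_fun [set: R] (@cos R).
Proof. by apply: continuous_measurable_fun; exact: continuous_cos. Qed.

Lemma measurable_sin : measurable_fun [set: R] (@sin R).
Proof. by apply: continuous_measurable_fun; exact: continuous_sin. Qed.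

Lemma normr_cos t : `|cos t| <= 1.
Proof. by rewrite ler_norml cos_geN1 cos_le1. Qed.

Lemma normr_sin t : `|sin t| <= 1.
Proof. by rewrite ler_norml sin_geN1 sin_le1. Qed.

Lemma integrable_bounded_mul d (T : measurableType d)
    (m : {measure set T -> \bar R}) (b h : T -> R) :
  measurable_fun [set: T] b -> (forall x, `|b x| <= 1) ->
  m.-integrable setT (EFin \o h) -> m.-integrable setT (EFin \o (fun x =>
    b x * h x)).
Proof.
move=> mb b1 hi; apply: le_integrable (hi) => //.
  apply/measurable_EFinP; apply: measurable_funM => //.
  by apply/measurable_EFinP; exact: measurable_int hi.
by move=> x _ /=; rewrite lee_fin normrM ler_piMl.
Qed.

(** For real [h] the Fourier transform with kernel [exp (- i x u)] is [fcos h - i fsin h]. *)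
Definition fcos h u : R := \int[mu]_x (cos (x * u) * h x).
Definition fsin h u : R := \int[mu]_x (sin (x * u) * h x).

Lemma integrable_cos_mul h u : mu.-integrable setT (EFin \o h) ->
  mu.-integrable setT (EFin \o (fun x => cos (x * u) * h x)).
Proof.
apply: integrable_bounded_mul => [|x]; last exact: normr_cos.
by apply: (measurableT_comp measurable_cos); exact: measurable_funM.
Qed.

Lemma integrable_sin_mul h u : mu.-integrable setT (EFin \o h) ->
  mu.-integrable setT (EFin \o (fun x => sin (x * u) * h x)).
Proof.
apply: integrable_bounded_mul => [|x]; last exact: normr_sin.
by apply: (measurableT_comp measurable_sin); exact: measurable_funM.
Qed.

Section integrable_function.
Context h (ih : mu.-integrable setT (EFin \o h)).

Let mh : measurable_fun [set: R] h.
Proof. by apply/measurable_EFinP; exact: measurable_int ih. Qed.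

(** For fixed [x], translating the second variable decouples the two factors: the integral of the
    modulus is the square of the L^1 norm of [h]. Integrability of the autocorrelation follows by
    Fubini. *)
Lemma integrable_mul_shift :
  (mu \x mu)%E.-integrable setT (EFin \o (fun z => h z.1 * h (z.1 + z.2))).
Proof.
apply/integrable12ltyP.
  apply/measurable_EFinP; apply: measurable_funM; apply: measurableT_comp => //.
  exact: measurable_funD.
have [_ iy] := integrableP _ _ _ ih.
have mn : measurable_fun [set: R] (fun x => `|(EFin \o h) x|%E).
  exact/measurableT_comp/measurable_EFinP.
rewrite [ltLHS](_ : _ = (\int[mu]_x (`|(h x)%:E| * \int[mu]_y `|(h y)%:E|))%E);
  last first.
  apply: eq_integral => x _.
  rewrite -(integral_shift x mn) -ge0_integralZl//; last first.
    by apply: (measurableT_comp mn); exact: measurable_funD.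
  by apply: eq_integral => y _; rewrite /= normrM EFinM (addrC y).
rewrite ge0_integralZr//; last exact: integral_ge0.
rewrite lte_mul_pinfty//; first exact: integral_ge0.
by rewrite ge0_fin_numE//; exact: integral_ge0.
Qed.

Lemma integrable_autocorr_fun : mu.-integrable setT (EFin \o autocorr h).
Proof. exact: integrable_marginal2 integrable_mul_shift. Qed.

Lemma Rintegral_cos_shift x u :
  \int[mu]_t (cos (t * u) * h (x + t)) = cos (x * u) * fcos h u +
    sin (x * u) * fsin h u.
Proof.
pose g y := cos ((y - x) * u) * h y.
have mg : measurable_fun [set: R] g.
  apply: measurable_funM => //; apply: (measurableT_comp measurable_cos).
  by apply: measurable_funM => //; exact: measurable_funB.
transitivity (\int[mu]_t g (t + x)).
  by apply: eq_Rintegral => t _; rewrite /g addrK (addrC x).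
rewrite Rintegral_shift//.
transitivity (\int[mu]_y (cos (x * u) * (cos (y * u) * h y) +
  sin (x * u) * (sin (y * u) * h y))).
  by apply: eq_Rintegral => y _; rewrite /g mulrBl cosB; ring.
have ic := integrable_cos_mul u ih; have is_ := integrable_sin_mul u ih.
rewrite RintegralD//; [|exact: integrable_EFinZl|exact: integrable_EFinZl].
by rewrite !RintegralZl.
Qed.

(** The Wiener-Khinchin identity. With [x] fixed, the integral over [t] is a combination of
    [fcos h u] and [fsin h u] with coefficients [cos (x * u)] and [sin (x * u)]; integrating these
    against [h x] produces the same two numbers again. *)
Lemma fcos_fsin_autocorr u : (\int[mu]_x (h x ^+ 2)%:E < +oo)%E ->
  fcos h u ^+ 2 + fsin h u ^+ 2 = \int[mu]_t (cos (t * u) * autocorr h t).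
Proof.
move=> h2.
have ic := integrable_cos_mul u ih; have is_ := integrable_sin_mul u ih.
pose k (z : R * R) := cos (z.2 * u) * (h z.1 * h (z.1 + z.2)).
have ik : (mu \x mu)%E.-integrable setT (EFin \o k).
  apply: integrable_bounded_mul integrable_mul_shift => [|z];
    last exact: normr_cos.
  by apply: (measurableT_comp measurable_cos); exact: measurable_funM.
transitivity (\int[mu]_t \int[mu]_x k (x, t)); last first.
  apply: eq_Rintegral => t _; rewrite /k /autocorr/=.
  by rewrite (RintegralZl _ measurableT (integrable_autocorr mh h2 t)).
rewrite -Rintegral_swap//.
transitivity (\int[mu]_x (fcos h u * (cos (x * u) * h x) +
  fsin h u * (sin (x * u) * h x))).
  rewrite RintegralD//; [|exact: integrable_EFinZl|exact: integrable_EFinZl].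
  by rewrite !RintegralZl// !expr2.
apply: eq_Rintegral => x _; rewrite /k/=.
under eq_Rintegral do rewrite mulrCA.
rewrite RintegralZl//; last first.
  apply: integrable_cos_mul.
  by apply: eq_integrable (integrable_shift x ih) => // t _; rewrite /= addrC.
rewrite Rintegral_cos_shift; ring.
Qed.

End integrable_function.
End fourier_autocorrelation.

(** * Plancherel in one variable *)

Section plancherel_half_line.
Context {R : realType}.
Notation mu := (@lebesgue_measure R).

Lemma integral_cauchy : (\int[mu]_x (((oneDsqr x)^-1)%:E) = pi%:E)%E.
Proof.
have m1 : measurable_fun [set: R] (fun x => ((oneDsqr x)^-1)%:E).
  apply/measurable_EFinP; apply: continuous_measurable_fun.
  exact: continuous_oneDsqrV.
rewrite ge0_integral_reflect//.
under eq_integral do rewrite /oneDsqr sqrrN -/(oneDsqr _) -mule2n -mule_natl.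
rewrite ge0_integralZl_EFin//.
- by rewrite integral0y_oneDsqr -EFinM; congr EFin; field.
- exact: measurable_funTS.
Qed.

Lemma integrable_cauchy : mu.-integrable setT (EFin \o (fun x : R =>
  (oneDsqr x)^-1)).
Proof.
apply: ge0_integrable.
- apply/measurable_EFinP; apply: continuous_measurable_fun.
  exact: continuous_oneDsqrV.
- by move=> x; rewrite lee_fin.
- by rewrite integral_cauchy ltry.
Qed.

Context h (ih : mu.-integrable setT (EFin \o h))
  (h2 : (\int[mu]_x (h x ^+ 2)%:E < +oo)%E).

Let mh : measurable_fun [set: R] h.
Proof. by apply/measurable_EFinP; exact: measurable_int ih. Qed.

Let G u := fcos h u ^+ 2 + fsin h u ^+ 2.

Let G_ge0 u : 0 <= G u. Proof. by rewrite addr_ge0 ?sqr_ge0. Qed.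

(** Here [z = (u, t)]: the weight provides the decay in [u] and the autocorrelation that in [t],
    which licenses the exchange of the two integrals. *)
Let iker c : 0 < c ->
  (mu \x mu)%E.-integrable setT (EFin \o (fun z =>
    expcos c z.2 z.1 * autocorr h z.2)).
Proof.
move=> c0; have it := integrable_tensor (integrable_expcos 0 c0)
  (integrable_autocorr_fun ih).
apply: le_integrable it => //.
  apply/measurable_EFinP; apply: measurable_funM.
    have sw : measurable_fun [set: R * R] (fun z => (z.2, z.1)).
      exact: measurable_fun_pair.
    exact: (measurableT_comp (measurable_expcos c) sw).
  apply: measurableT_comp => //; exact: measurable_autocorr.
move=> z _ /=; rewrite lee_fin [leLHS]normrM [leRHS]normrM ler_wpM2r//.
by rewrite (le_trans (normr_expcos c z.2 z.1))// ler_norm.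
Qed.

Let weightedE c u : 0 < c ->
  expcos c 0 u * G u = \int[mu]_t (expcos c t u * autocorr h t).
Proof.
move=> c0; rewrite /G fcos_fsin_autocorr// -RintegralZl//; last first.
  exact: integrable_cos_mul (integrable_autocorr_fun ih).
apply: eq_Rintegral => t _; rewrite /expcos mul0r cos0; ring.
Qed.

Let integrable_weighted c : 0 < c ->
  mu.-integrable setT (EFin \o (fun u => expcos c 0 u * G u)).
Proof.
move=> c0; apply: eq_integrable (integrable_marginal1 (iker c0)) => // u _.
by rewrite /= weightedE.
Qed.

Let integrable_cauchy_autocorr c :
  mu.-integrable setT (EFin \o (fun s => (oneDsqr s)^-1 * autocorr h (c * s))).
Proof.
apply: le_integrable (integrable_EFinZl (sqn h) measurableT integrable_cauchy)
  => //.
  apply/measurable_EFinP; apply: measurable_funM.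
    by apply/measurable_EFinP; exact: measurable_int integrable_cauchy.
  have ma : measurable_fun [set: R] (autocorr h) by exact: measurable_autocorr.
  by apply: (measurableT_comp ma); exact: measurable_funM.
move=> s _; rewrite /= lee_fin [leLHS]normrM [leLHS]mulrC [leRHS]normrM
  ler_wpM2r//.
by rewrite (le_trans (autocorr_le _ _ _))// ler_norm.
Qed.

(** The substitution [t = c s] moves [c] out of the kernel and into the argument of [autocorr]; a
    fixed multiple of the Cauchy density then dominates for all [c]. *)
Let integral_weighted c : 0 < c ->
  (\int[mu]_u (expcos c 0 u * G u)%:E =
   (\int[mu]_s ((oneDsqr s)^-1 * autocorr h (c * s)))%:E)%E.
Proof.
move=> c0; rewrite -[LHS]fineK; last exact: integrable_fin_num
  (integrable_weighted c0).
congr EFin; rewrite -[LHS]/(\int[mu]_u (expcos c 0 u * G u)).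
under eq_Rintegral do rewrite weightedE//.
rewrite (Rintegral_swap (iker c0)).
transitivity (\int[mu]_t (c / (c ^+ 2 + t ^+ 2) * autocorr h t)).
  apply: eq_Rintegral => t _ /=.
  by rewrite RintegralZr ?Rintegral_expcos//; exact: integrable_expcos.
rewrite (Rintegral_scale c0); last first.
  apply: measurable_funM; last exact: measurable_autocorr.
  apply: continuous_measurable_fun => t; apply: cvgM; first exact: cvg_cst.
  apply: cvgV; first by rewrite gt_eqF// ltr_pwDl ?exprn_gt0// sqr_ge0.
  by apply: cvgD; [exact: cvg_cst|exact: exprn_continuous].
rewrite -RintegralZl//; last first.
  apply: eq_integrable (integrable_EFinZl c^-1 measurableT
    (integrable_cauchy_autocorr c)) => // s _.
  rewrite /= /oneDsqr; congr EFin; field.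
  by rewrite !gt_eqF// ltr_pwDl ?sqr_ge0// exprn_gt0.
apply: eq_Rintegral => s _; rewrite /oneDsqr; field.
by rewrite !gt_eqF// ltr_pwDl ?sqr_ge0// exprn_gt0.
Qed.

(** Decreasing to 0, as monotone convergence requires, and at most 1, so that [c_ n * s] stays
    within the bound [|s|] passed to [cvg_autocorr]. *)
Let c_ n : R := n.+1%:R^-1.

Let c_gt0 n : 0 < c_ n. Proof. by rewrite invr_gt0. Qed.

Let cvg_c : c_ n @[n --> \oo] --> 0.
Proof. exact: cvg_harmonic. Qed.

Let cvg_weighted :
  (\int[mu]_u (expcos (c_ n) 0 u * G u)%:E)%E @[n --> \oo] --> (pi * sqn h)%:E.
Proof.
have -> : (pi * sqn h)%:E = (\int[mu]_s ((oneDsqr s)^-1 * sqn h)%:E)%E.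
  under eq_integral do rewrite EFinM.
  rewrite ge0_integralZr//; last 2 first.
  - by apply: measurable_int integrable_cauchy.
  - by rewrite lee_fin; apply: Rintegral_ge0 => x _; exact: sqr_ge0.
  by rewrite integral_cauchy EFinM.
have E n : ((\int[mu]_s ((oneDsqr s)^-1 * autocorr h (c_ n * s)))%:E =
    \int[mu]_s ((oneDsqr s)^-1 * autocorr h (c_ n * s))%:E)%E.
  by rewrite /Rintegral fineK//; exact: integrable_fin_num
    (integrable_cauchy_autocorr _).
under eq_cvg do rewrite integral_weighted// E.
apply: (@dominated_cvg _ _ _ mu setT measurableT _ _
  (fun s => ((oneDsqr s)^-1 * sqn h)%:E)) => //.
- by move=> n; exact: measurable_int (integrable_cauchy_autocorr (c_ n)).
- move=> s _; apply: cvg_EFin; first by near=> n.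
  apply: cvgM; first exact: cvg_cst.
  apply: (cvg_autocorr mh h2 (T := `|s|)).
    rewrite -(mul0r s); apply: cvgM; [exact: cvg_c|exact: cvg_cst].
  move=> n; rewrite normrM gtr0_norm// ler_piMl//.
  by rewrite invf_le1// ler1n.
- apply: eq_integrable (integrable_EFinZl (sqn h) measurableT integrable_cauchy)
    => //.
  by move=> s _; rewrite /= mulrC.
- move=> n s _; rewrite /= lee_fin normrM ger0_norm ?invr_ge0//.
  by rewrite ler_wpM2l ?invr_ge0//; exact: autocorr_le.
Unshelve. all: by end_near.
Qed.

(** The left side needs monotone rather than dominated convergence, because finiteness of the
    integral of the squared modulus is part of the conclusion. *)
Lemma plancherel_half_line :
  (\int[mu]_(u in `[0%R, +oo[) (fcos h u ^+ 2 + fsin h u ^+ 2)%:E =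
   (pi * sqn h)%:E)%E.
Proof.
have mw n : measurable_fun [set: R] (fun u => (expcos (c_ n) 0 u * G u)%:E).
  by apply: measurable_int (integrable_weighted (c_gt0 n)).
have mc := @cvg_monotone_convergence _ _ _ mu setT measurableT
  (fun n u => (expcos (c_ n) 0 u * G u)%:E) mw.
have -> : (\int[mu]_(u in `[0%R, +oo[) (fcos h u ^+ 2 + fsin h u ^+ 2)%:E =
    \int[mu]_u limn (fun n => (expcos (c_ n) 0 u * G u)%:E))%E.
  rewrite [LHS]integral_mkcond; apply: eq_integral => u _;
    apply/esym/cvg_lim => //.
  (* The limit is written as the weighted integrand at [c = 0], so that continuity of the
     exponential gives the convergence. *)
  have -> : ((fun u => (fcos h u ^+ 2 + fsin h u ^+ 2)%:E) \_ `[0%R, +oo[) u =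
      (\1_(`[0%R, +oo[%classic : set R) u * (expR (- (0 * u)) * cos (0 * u)) * G
        u)%:E.
    rewrite patchE indicE !mul0r oppr0 expR0 cos0 mulr1.
    by case: ifPn => _; rewrite ?mul1r ?mul0r.
  apply: cvg_EFin; first by near=> n.
  apply: cvgM; last exact: cvg_cst.
  apply: cvgM; first exact: cvg_cst.
  apply: cvgM; last exact: cvg_cst.
  apply: continuous_cvg; first exact: continuous_expR.
  by apply: cvgN; apply: cvgM; [exact: cvg_c|exact: cvg_cst].
apply: (cvg_unique _ _ cvg_weighted) => //; apply: mc.
- move=> n u _; rewrite lee_fin mulr_ge0//.
  exact: le_trans (normr_expcos (c_ n) 0 u).
- move=> u _ n m nm; rewrite lee_fin ler_wpM2r// /expcos mul0r cos0 !mulr1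
    indicE.
  have [u0|] := boolP (u \in (`[0%R, +oo[%classic : set R));
    last by rewrite !mul0r.
  rewrite !mul1r ler_expR lerN2 ler_wpM2r//.
    by move: u0; rewrite inE/= in_itv/= andbT.
  by rewrite lef_pV2 ?posrE// ler_nat.
Unshelve. all: by end_near.
Qed.

End plancherel_half_line.

Section plancherel_line.
Context {R : realType}.
Notation mu := (@lebesgue_measure R).
Implicit Types (a b h : R -> R) (u : R).

(* The real and imaginary parts of the Fourier transform of [a + i b] are
   [rot_transform a b] and [rot_transform b (- a)]. *)
Definition rot_transform a b u : R := \int[mu]_x (cos (x * u) * a x +
  sin (x * u) * b x).

Lemma measurable_fcos h : mu.-integrable setT (EFin \o h) ->
  measurable_fun [set: R] (fcos h).
Proof.
move=> ih; have mh : measurable_fun [set: R] h.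
  by apply/measurable_EFinP; exact: measurable_int ih.
apply: (@measurable_fun_param_Rintegral _ _ _ _ _ mu (fun p =>
  cos (p.2 * p.1) * h p.2)).
apply: measurable_funM; last exact: measurableT_comp.
by apply: (measurableT_comp measurable_cos); exact: measurable_funM.
Qed.

Lemma measurable_fsin h : mu.-integrable setT (EFin \o h) ->
  measurable_fun [set: R] (fsin h).
Proof.
move=> ih; have mh : measurable_fun [set: R] h.
  by apply/measurable_EFinP; exact: measurable_int ih.
apply: (@measurable_fun_param_Rintegral _ _ _ _ _ mu (fun p =>
  sin (p.2 * p.1) * h p.2)).
apply: measurable_funM; last exact: measurableT_comp.
by apply: (measurableT_comp measurable_sin); exact: measurable_funM.
Qed.

Lemma fcosN h u : fcos h (- u) = fcos h u.
Proof. by apply: eq_Rintegral => x _; rewrite mulrN cosN. Qed.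

Lemma fsinN h u : mu.-integrable setT (EFin \o h) -> fsin h (- u) = - fsin h u.
Proof.
move=> ih; rewrite -[RHS]mulN1r /fsin -RintegralZl//;
  last exact: integrable_sin_mul.
by apply: eq_Rintegral => x _; rewrite mulrN sinN mulNr mulN1r.
Qed.

Context a b (ia : mu.-integrable setT (EFin \o a)) (ib : mu.-integrable setT
  (EFin \o b))
  (a2 : (\int[mu]_x (a x ^+ 2)%:E < +oo)%E) (b2 : (\int[mu]_x (b x ^+ 2)%:E <
    +oo)%E).

Lemma rot_transformE u : rot_transform a b u = fcos a u + fsin b u.
Proof.
by rewrite /rot_transform RintegralD//; [exact: integrable_cos_mul|exact:
  integrable_sin_mul].
Qed.

Lemma rot_transformNE u : rot_transform b (fun x =>
  - a x) u = fcos b u - fsin a u.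
Proof.
rewrite /rot_transform; under eq_Rintegral do rewrite mulrN.
by rewrite RintegralB//; [exact: integrable_cos_mul|exact: integrable_sin_mul].
Qed.

Lemma plancherel_line :
  (\int[mu]_u (rot_transform a b u ^+ 2 + rot_transform b (fun x =>
    (- a x)%R) u ^+ 2)%:E =
   (2 * pi)%:E * \int[mu]_x (a x ^+ 2 + b x ^+ 2)%:E)%E.
Proof.
have mca := measurable_fcos ia; have msa := measurable_fsin ia.
have mcb := measurable_fcos ib; have msb := measurable_fsin ib.
under eq_integral do rewrite rot_transformE rot_transformNE.
rewrite [LHS]ge0_integral_reflect; last 2 first.
- apply/measurable_EFinP; apply: measurable_funD; apply: measurable_funX.
    exact: measurable_funD.
  exact: measurable_funB.
- by move=> u; rewrite lee_fin addr_ge0 ?sqr_ge0.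
pose G h u := fcos h u ^+ 2 + fsin h u ^+ 2.
have mG h : measurable_fun setT (fcos h) -> measurable_fun setT (fsin h) ->
    measurable_fun (`[0, +oo[%classic : set R) (fun u => (G h u)%:E).
  move=> mc ms; apply: measurable_funTS; apply/measurable_EFinP.
  by apply: measurable_funD; exact: measurable_funX.
(* The cross term [2 (fcos a u * fsin b u - fcos b u * fsin a u)] changes sign with [u], while [G a]
   and [G b] are even; hence the factor 2. *)
transitivity (\int[mu]_(u in `[0%R, +oo[) (2%:E * ((G a u)%:E + (G b u)%:E)))%E.
  apply: eq_integral => u _; rewrite !fcosN !fsinN// -!EFinD -EFinM.
  by congr EFin; rewrite /G; ring.
have G0 h u : (0 <= (G h u)%:E)%E by rewrite lee_fin addr_ge0 ?sqr_ge0.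
rewrite ge0_integralZl_EFin//; last 2 first.
- by move=> u _; exact: adde_ge0.
- by apply: emeasurable_funD; exact: mG.
rewrite ge0_integralD//; [|exact: mG|exact: mG].
rewrite !plancherel_half_line//.
have sE h : measurable_fun setT h -> (\int[mu]_x (h x ^+ 2)%:E < +oo)%E ->
    (\int[mu]_x (h x ^+ 2)%:E)%E = (sqn h)%:E.
  by move=> mh h2; rewrite /sqn /Rintegral fineK//;
    exact: integrable_fin_num (integrable_sqr mh h2).
have ma : measurable_fun [set: R] a by apply/measurable_EFinP;
  exact: measurable_int ia.
have mb : measurable_fun [set: R] b by apply/measurable_EFinP;
  exact: measurable_int ib.
under [in RHS]eq_integral do rewrite EFinD.
rewrite ge0_integralD//; last 4 first.
- by move=> x _; rewrite lee_fin sqr_ge0.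
- exact: measurable_sqrE.
- by move=> x _; rewrite lee_fin sqr_ge0.
- exact: measurable_sqrE.
rewrite (sE a ma a2) (sE b mb b2) -(EFinD (pi * _)) -(EFinM 2) -EFinD -EFinM.
by congr EFin; ring.
Qed.

End plancherel_line.

(** * Plancherel on slices of the plane *)

Section plancherel_slices.
Context {R : realType}.
Notation mu := (@lebesgue_measure R).
Implicit Types (a b : R -> R -> R).

Lemma measurable_rot_transform a b :
  measurable_fun [set: R * R] (fun z => a z.1 z.2) ->
  measurable_fun [set: R * R] (fun z => b z.1 z.2) ->
  measurable_fun [set: R * R] (fun z => rot_transform (a z.1) (b z.1) z.2).
Proof.
move=> ma mb.
pose k (w : (R * R) * R) :=
  cos (w.2 * w.1.2) * a w.1.1 w.2 + sin (w.2 * w.1.2) * b w.1.1 w.2.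
apply: (@measurable_fun_param_Rintegral _ _ _ _ _ mu k).
have m1 : measurable_fun [set: (R * R) * R] (fun w => w.2 * w.1.2).
  by apply: measurable_funM => //; exact: measurableT_comp.
have m2 : measurable_fun [set: (R * R) * R] (fun w => (w.1.1, w.2)).
  by apply: measurable_fun_pair => //; exact: measurableT_comp.
apply: measurable_funD; apply: measurable_funM.
- exact: (measurableT_comp measurable_cos m1).
- exact: (measurableT_comp ma m2).
- exact: (measurableT_comp measurable_sin m1).
- exact: (measurableT_comp mb m2).
Qed.

Lemma measurable_curry_opp a :
  measurable_fun [set: R * R] (fun z => a z.1 z.2) ->
  measurable_fun [set: R * R] (fun z => - a z.1 z.2).
Proof. by move=> ma; exact: measurableT_comp. Qed.

Lemma measurable_sum_sqr d (T : measurableType d) (g h : T -> R) :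
  measurable_fun [set: T] g -> measurable_fun [set: T] h ->
  measurable_fun [set: T] (fun z => (g z ^+ 2 + h z ^+ 2)%:E).
Proof.
by move=> mg mh; apply/measurable_EFinP; apply: measurable_funD;
  exact: measurable_funX.
Qed.

(** Integrability is asked of almost every slice and not of [a] and [b] on the plane, because the
    lemma must also apply to functions already transformed in the other variable. *)
Lemma plancherel_slices a b :
  measurable_fun [set: R * R] (fun z => a z.1 z.2) ->
  measurable_fun [set: R * R] (fun z => b z.1 z.2) ->
  {ae mu, forall p, mu.-integrable setT (EFin \o a p)} ->
  {ae mu, forall p, mu.-integrable setT (EFin \o b p)} ->
  (\int[mu]_p \int[mu]_x (a p x ^+ 2 + b p x ^+ 2)%:E < +oo)%E ->
  (\int[mu]_p \int[mu]_u (rot_transform (a p) (b p) u ^+ 2 +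
     rot_transform (b p) (fun x => (- a p x)%R) u ^+ 2)%:E =
   (2 * pi)%:E * \int[mu]_p \int[mu]_x (a p x ^+ 2 + b p x ^+ 2)%:E)%E.
Proof.
move=> ma mb ia ib fin.
have m2 := measurable_sum_sqr ma mb.
have mF := measurable_fun_fubini_tonelli_F (m2 := mu) _ m2.
have {mF} mF : measurable_fun [set: R] (fun p =>
  \int[mu]_x (a p x ^+ 2 + b p x ^+ 2)%:E)%E.
  by apply: mF => z; rewrite lee_fin addr_ge0 ?sqr_ge0.
rewrite -ge0_integralZl_EFin//; last 2 first.
- by move=> p _; apply: integral_ge0 => x _; rewrite lee_fin addr_ge0 ?sqr_ge0.
- by rewrite mulr_ge0// pi_ge0.
apply: ge0_ae_eq_integral => //.
- have mt := measurable_sum_sqr (@measurable_rot_transform a b ma mb)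
    (@measurable_rot_transform b (fun p x => - a p x) mb (@measurable_curry_opp
      a ma)).
  have mG := measurable_fun_fubini_tonelli_F (m2 := mu) _ mt.
  by apply: mG => z; rewrite lee_fin addr_ge0 ?sqr_ge0.
- exact: measurable_funeM.
- by move=> p _; apply: integral_ge0 => u _; rewrite lee_fin addr_ge0 ?sqr_ge0.
- move=> p _; apply: mule_ge0; first by rewrite lee_fin mulr_ge0// pi_ge0.
  by apply: integral_ge0 => x _; rewrite lee_fin addr_ge0 ?sqr_ge0.
have iF : mu.-integrable setT (fun p => \int[mu]_x (a p x ^+ 2 +
  b p x ^+ 2)%:E)%E.
  apply: ge0_integrable => // p.
  by apply: integral_ge0 => x _; rewrite lee_fin addr_ge0 ?sqr_ge0.
(* A finite double integral has finite inner integrals almost everywhere, so almost every slice is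
   square integrable. *)
have fF := integrable_ae measurableT iF.
apply: (@filterS3 _ _ (ae_filter_ringOfSetsType mu) _ _ _ _ _ ia ib fF) =>
  p iap ibp /(_ I) fp _.
have map : measurable_fun [set: R] (a p) by apply/measurable_EFinP;
  exact: measurable_int iap.
have mbp : measurable_fun [set: R] (b p) by apply/measurable_EFinP;
  exact: measurable_int ibp.
have m2p := measurable_sum_sqr map mbp.
have finp : (\int[mu]_x (a p x ^+ 2 + b p x ^+ 2)%:E < +oo)%E by
  move/fin_numPlt: fp => /andP[].
apply: plancherel_line => //; apply: le_lt_trans finp;
  apply: ge0_le_integral => //.
- by move=> x _; rewrite lee_fin sqr_ge0.
- exact: measurable_sqrE.
- by move=> x _; rewrite lee_fin lerDl sqr_ge0.
- by move=> x _; rewrite lee_fin sqr_ge0.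
- exact: measurable_sqrE.
- by move=> x _; rewrite lee_fin lerDr sqr_ge0.
Qed.

End plancherel_slices.

Section plancherel_plane.
Context {R : realType}.
Notation mu := (@lebesgue_measure R).
Notation mu2 := (@lebesgue_measure R \x @lebesgue_measure R)%E.

Section nonnegative_double_integral.
Implicit Types (g h : R * R -> \bar R).

Lemma integral_prod_swap g : measurable_fun [set: R * R] g ->
  (forall z, (0 <= g z)%E) ->
  (\int[mu2]_z g z = \int[mu2]_z g (z.2, z.1))%E.
Proof.
move=> mg g0; rewrite (fubini_tonelli1 (m1 := mu) (m2 := mu) g)//.
rewrite (fubini_tonelli2 (m1 := mu) (m2 := mu) (fun z => g (z.2, z.1)))//.
have sw : measurable_fun [set: R * R] (fun z => (z.2, z.1)).
  exact: measurable_fun_pair.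
exact: (measurableT_comp mg sw).
Qed.

Lemma plancherel_slices_prod (a b : R -> R -> R) :
  measurable_fun [set: R * R] (fun z => a z.1 z.2) ->
  measurable_fun [set: R * R] (fun z => b z.1 z.2) ->
  {ae mu, forall p, mu.-integrable setT (EFin \o a p)} ->
  {ae mu, forall p, mu.-integrable setT (EFin \o b p)} ->
  (\int[mu2]_z (a z.1 z.2 ^+ 2 + b z.1 z.2 ^+ 2)%:E < +oo)%E ->
  (\int[mu2]_z (rot_transform (a z.1) (b z.1) z.2 ^+ 2 +
     rot_transform (b z.1) (fun x => (- a z.1 x)%R) z.2 ^+ 2)%:E =
   (2 * pi)%:E * \int[mu2]_z (a z.1 z.2 ^+ 2 + b z.1 z.2 ^+ 2)%:E)%E.
Proof.
move=> ma mb ia ib.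
have m2 := measurable_sum_sqr ma mb.
have mt := measurable_sum_sqr (@measurable_rot_transform R a b ma mb)
  (@measurable_rot_transform R b (fun p x => - a p x) mb (@measurable_curry_opp
    R a ma)).
have g0 (x y : R) : (0 <= (x ^+ 2 + y ^+ 2)%:E)%E.
  by rewrite lee_fin addr_ge0 ?sqr_ge0.
rewrite (fubini_tonelli1 (m1 := mu) (m2 := mu) (fun z : R * R =>
  (a z.1 z.2 ^+ 2 + b z.1 z.2 ^+ 2)%:E))//.
rewrite (fubini_tonelli1 (m1 := mu) (m2 := mu) (fun z : R * R =>
  (rot_transform (a z.1) (b z.1) z.2 ^+ 2 +
     rot_transform (b z.1) (fun x => (- a z.1 x)%R) z.2 ^+ 2)%:E))//=.
exact: plancherel_slices.
Qed.

End nonnegative_double_integral.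

Section iterated_transform.
Implicit Types (a b c d : R * R -> R).

Definition slice_transform a b (y u : R) : R :=
  rot_transform (fun x => a (x, y)) (fun x => b (x, y)) u.

Lemma measurable_slice_transform a b :
  measurable_fun [set: R * R] a -> measurable_fun [set: R * R] b ->
  measurable_fun [set: R * R] (fun z => slice_transform a b z.1 z.2).
Proof.
move=> ma mb; have sw : measurable_fun [set: R * R] (fun z => (z.2, z.1)).
  exact: measurable_fun_pair.
exact: (@measurable_rot_transform R (fun y x => a (x, y)) (fun y x => b (x, y))
  (measurableT_comp ma sw) (measurableT_comp mb sw)).
Qed.

Lemma integrable_bounded_comb (disp : measure_display) (T : measurableType disp)
    (m : {measure set T -> \bar R}) (p q : T -> R) (th : T -> R) :
  measurable_fun [set: T] th ->
  m.-integrable setT (EFin \o p) -> m.-integrable setT (EFin \o q) ->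
  m.-integrable setT (EFin \o (fun z => cos (th z) * p z + sin (th z) * q z)).
Proof.
move=> mth ip iq; apply: integrable_EFinD => //.
- apply: integrable_bounded_mul ip => [|z]; last exact: normr_cos.
  exact: (measurableT_comp measurable_cos mth).
- apply: integrable_bounded_mul iq => [|z]; last exact: normr_sin.
  exact: (measurableT_comp measurable_sin mth).
Qed.

Let mfst_mul (u : R) : measurable_fun [set: plane R] (fun z => z.1 * u).
Proof.
have : measurable_fun [set: R * R] (fun z => z.1 * u) by exact: measurable_funM.
exact.
Qed.

Let msnd_mul (u : R) : measurable_fun [set: plane R] (fun z => z.2 * u).
Proof.
have : measurable_fun [set: R * R] (fun z => z.2 * u) by exact: measurable_funM.
exact.
Qed.

(** This holds for every frequency [u]: the kernel is bounded, so the integrand is integrable on the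
    plane and so is its marginal in [y]. *)
Lemma integrable_slice_transform a b u :
  mu2.-integrable setT (EFin \o a) -> mu2.-integrable setT (EFin \o b) ->
  mu.-integrable setT (EFin \o (fun y => slice_transform a b y u)).
Proof.
move=> ia ib; apply: (@integrable_marginal2 _ _ _ _ R mu mu
  (fun z : R * R => cos (z.1 * u) * a z + sin (z.1 * u) * b z)).
exact: integrable_bounded_comb (mfst_mul u) ia ib.
Qed.

(** [e] stands for a sign: all four components of the quaternion integrand have this shape, with [e]
    equal to 1 or -1. *)
Lemma iterated_transformE (e : R) a b c d (u v : R) :
  mu2.-integrable setT (EFin \o a) -> mu2.-integrable setT (EFin \o b) ->
  mu2.-integrable setT (EFin \o c) -> mu2.-integrable setT (EFin \o d) ->
  \int[mu2]_z (cos (z.2 * v) * (cos (z.1 * u) * a z + sin (z.1 * u) * b z) +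
     sin (z.2 * v) * (e * (cos (z.1 * u) * c z + sin (z.1 * u) * d z))) =
  rot_transform (fun y => slice_transform a b y u)
    (fun y => e * slice_transform c d y u) v.
Proof.
move=> ia ib ic id.
have iab := integrable_bounded_comb (mfst_mul u) ia ib.
have icd := integrable_bounded_comb (mfst_mul u) ic id.
have ik := integrable_bounded_comb (msnd_mul v) iab (integrable_EFinZl e
  measurableT icd).
rewrite (Rintegral_prod2 ik) /rot_transform; congr fine.
have iA := integrable_slice_transform u ia ib.
have iC := integrable_slice_transform u ic id.
apply: ae_eq_integral => //.
- exact: measurable_int (integrable_marginal2 ik).
- apply: (measurable_int mu); apply: integrable_bounded_comb => //.
    exact: measurable_funM.
  exact: integrable_EFinZl.
have F := ae_filter_ringOfSetsType mu.
apply: (@filterS2 _ _ F _ _ _ _ (ae_integrable2 iab) (ae_integrable2 icd)) =>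
  y iaby icdy _ /=.
congr EFin; rewrite RintegralD//; last 2 first.
- exact: integrable_EFinZl.
- by apply: integrable_EFinZl => //; exact: integrable_EFinZl.
rewrite RintegralZl// RintegralZl//; last exact: integrable_EFinZl.
by rewrite RintegralZl.
Qed.

End iterated_transform.
End plancherel_plane.

(** * Plancherel in both variables for four real components *)

Section four_components.
Context {R : realType}.
Notation mu := (@lebesgue_measure R).
Notation mu2 := (@lebesgue_measure R \x @lebesgue_measure R)%E.
Implicit Types (a b c d : R * R -> R).

Lemma integrable_EFinN a : mu2.-integrable setT (EFin \o a) ->
  mu2.-integrable setT (EFin \o (fun z => - a z)).
Proof.
move=> ia; apply: eq_integrable (integrable_EFinZl (-1) measurableT ia) =>
  // z _.
by rewrite /= mulN1r.
Qed.

Lemma measurable_integrable_plane a : mu2.-integrable setT (EFin \o a) ->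
  measurable_fun [set: R * R] a.
Proof. by move=> ia; apply/measurable_EFinP; exact: measurable_int ia. Qed.

Let S a b := (\int[mu2]_z (a z ^+ 2 + b z ^+ 2)%:E)%E.

Let ge0_sum2 (x y : R) : (0 <= (x ^+ 2 + y ^+ 2)%:E)%E.
Proof. by rewrite lee_fin addr_ge0 ?sqr_ge0. Qed.

Let S_ge0 a b : (0 <= S a b)%E. Proof. by apply: integral_ge0 => z _. Qed.

Let SD a b c d : measurable_fun [set: R * R] a ->
  measurable_fun [set: R * R] b ->
  measurable_fun [set: R * R] c -> measurable_fun [set: R * R] d ->
  (\int[mu2]_z ((a z ^+ 2 + b z ^+ 2) + (c z ^+ 2 + d z ^+ 2))%:E =
    S a b + S c d)%E.
Proof.
move=> ma mb mc md; under eq_integral do rewrite EFinD.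
by rewrite ge0_integralD//; exact: measurable_sum_sqr.
Qed.

Let swap_fun a : R * R -> R := fun z => a (z.2, z.1).

Let measurable_swap a : measurable_fun [set: R * R] a ->
  measurable_fun [set: R * R] (swap_fun a).
Proof.
move=> ma; have sw : measurable_fun [set: R * R] (fun z => (z.2, z.1)).
  exact: measurable_fun_pair.
exact: (measurableT_comp ma sw).
Qed.

Let S_swap a b : measurable_fun [set: R * R] a ->
  measurable_fun [set: R * R] b ->
  S a b = S (swap_fun a) (swap_fun b).
Proof.
move=> ma mb; have h := measurable_sum_sqr ma mb.
exact: (integral_prod_swap h (fun z => ge0_sum2 (a z) (b z))).
Qed.

Let pi2_ge0 : 0 <= 2 * pi :> R. Proof. by rewrite mulr_ge0// pi_ge0. Qed.

Section first_variable.
Context a b (ia : mu2.-integrable setT (EFin \o a)) (ib : mu2.-integrable setT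
  (EFin \o b)).

(** Here [z = (u, y)]: the frequency takes the place of the first coordinate, and the second is left
    for the next transform. *)
Definition plane_transform a b : R * R -> R := fun z =>
  slice_transform a b z.2 z.1.

Lemma measurable_plane_transform : measurable_fun [set: R * R] (plane_transform
  a b).
Proof.
have ma := measurable_integrable_plane ia; have mb :=
  measurable_integrable_plane ib.
exact: (measurable_swap (measurable_slice_transform ma mb)).
Qed.

(** [plancherel_slices_prod] transforms the second coordinate with the first as parameter, whence
    the exchange of coordinates on both sides. Almost every slice in [x] is integrable by Fubini. *)
Lemma plancherel_first_variable : (S a b < +oo)%E ->
  (S (plane_transform a b) (plane_transform b (fun z => (- a z)%R)) =
   (2 * pi)%:E * S a b)%E.
Proof.
have ma := measurable_integrable_plane ia; have mb :=
  measurable_integrable_plane ib.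
have mta := measurable_slice_transform ma mb.
have mtb := measurable_slice_transform mb (measurable_integrable_plane
  (integrable_EFinN ia)).
move=> fin; rewrite (_ : S _ _ = S (fun z => slice_transform a b z.1 z.2)
    (fun z => slice_transform b (fun z => (- a z)%R) z.1 z.2)); last first.
  by rewrite (S_swap mta mtb).
have Sab := S_swap ma mb; rewrite Sab in fin *.
exact: (@plancherel_slices_prod R (fun y x => a (x, y)) (fun y x => b (x, y))
  (measurable_swap ma) (measurable_swap mb) (ae_integrable2 ia) (ae_integrable2
    ib) fin).
Qed.

End first_variable.

Let plancherel_second_variable a b :
  measurable_fun [set: R * R] a -> measurable_fun [set: R * R] b ->
  (forall u, mu.-integrable setT (EFin \o (fun y => a (u, y)))) ->
  (forall u, mu.-integrable setT (EFin \o (fun y => b (u, y)))) ->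
  (S a b < +oo)%E ->
  (S (fun z => rot_transform (fun y => a (z.1, y)) (fun y => b (z.1, y)) z.2)
     (fun z => rot_transform (fun y => b (z.1, y)) (fun y =>
       (- a (z.1, y))%R) z.2) =
   (2 * pi)%:E * S a b)%E.
Proof.
move=> ma mb ia ib.
have mE c : measurable_fun [set: R * R] c -> measurable_fun [set: R * R] (fun z
  => c (z.1, z.2)).
  by move=> mc; under eq_fun do rewrite -surjective_pairing.
have SE c d : S c d = S (fun z => c (z.1, z.2)) (fun z => d (z.1, z.2)).
  by apply: eq_integral => z _; rewrite -surjective_pairing.
rewrite (SE a b) => fin.
exact: (@plancherel_slices_prod R (fun u y => a (u, y)) (fun u y => b (u, y))
  (mE a ma) (mE b mb) (aeW mu ia) (aeW mu ib) fin).
Qed.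

Let measurable_second_variable a b :
  measurable_fun [set: R * R] a -> measurable_fun [set: R * R] b ->
  measurable_fun [set: R * R]
    (fun z => rot_transform (fun y => a (z.1, y)) (fun y => b (z.1, y)) z.2).
Proof.
move=> ma mb.
have mE c : measurable_fun [set: R * R] c -> measurable_fun [set: R * R] (fun z
  => c (z.1, z.2)).
  by move=> mc; under eq_fun do rewrite -surjective_pairing.
exact: (@measurable_rot_transform R (fun u y => a (u, y)) (fun u y =>
  b (u, y)) (mE a ma) (mE b mb)).
Qed.

Section both_variables.
Context a b c d (ia : mu2.-integrable setT (EFin \o a)) (ib : mu2.-integrable
  setT (EFin \o b))
  (ic : mu2.-integrable setT (EFin \o c)) (id : mu2.-integrable setT (EFin \o
    d)).

Let Fa := plane_transform a b.
Let Fb := plane_transform b (fun z => - a z).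
Let Fc := plane_transform c d.
Let Fd := plane_transform d (fun z => - c z).

Let mFa : measurable_fun [set: R * R] Fa.
Proof. exact: measurable_plane_transform. Qed.
Let mFb : measurable_fun [set: R * R] Fb.
Proof. by apply: measurable_plane_transform => //; exact: integrable_EFinN. Qed.
Let mFc : measurable_fun [set: R * R] Fc.
Proof. exact: measurable_plane_transform. Qed.
Let mFd : measurable_fun [set: R * R] Fd.
Proof. by apply: measurable_plane_transform => //; exact: integrable_EFinN. Qed.

Let mN (h : R * R -> R) : measurable_fun [set: R * R] h ->
  measurable_fun [set: R * R] (fun z => - h z).
Proof. by move=> mh; exact: measurableT_comp. Qed.

(** With [a], [b], [c], [d] the components along 1, i, j, k, these are the squared components of the
    quaternion transform in the order r, j, i, k, grouped as right multiplication by [j] couples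
    them. *)
Definition iterated_sqr_norm (z : R * R) : R :=
  (rot_transform (fun y => Fa (z.1, y)) (fun y => Fc (z.1, y)) z.2 ^+ 2 +
   rot_transform (fun y => Fc (z.1, y)) (fun y => - Fa (z.1, y)) z.2 ^+ 2) +
  (rot_transform (fun y => Fb (z.1, y)) (fun y => Fd (z.1, y)) z.2 ^+ 2 +
   rot_transform (fun y => Fd (z.1, y)) (fun y => - Fb (z.1, y)) z.2 ^+ 2).

Lemma measurable_iterated_sqr_norm : measurable_fun [set: R * R]
  iterated_sqr_norm.
Proof.
apply: measurable_funD; apply: measurable_funD; apply: measurable_funX.
- exact: measurable_second_variable.
- exact: (measurable_second_variable mFc (mN mFa)).
- exact: measurable_second_variable.
- exact: (measurable_second_variable mFd (mN mFb)).
Qed.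

Lemma plancherel_four_components :
  (\int[mu2]_z ((a z ^+ 2 + b z ^+ 2) + (c z ^+ 2 + d z ^+ 2))%:E < +oo)%E ->
  (\int[mu2]_z (iterated_sqr_norm z)%:E = ((2 * pi) ^+ 2)%:E *
    \int[mu2]_z ((a z ^+ 2 + b z ^+ 2) + (c z ^+ 2 + d z ^+ 2))%:E)%E.
Proof.
have ma := measurable_integrable_plane ia; have mb :=
  measurable_integrable_plane ib.
have mc := measurable_integrable_plane ic; have md :=
  measurable_integrable_plane id.
rewrite SD// => fin.
have Sab : (S a b < +oo)%E by apply: le_lt_trans fin; rewrite leeDl.
have Scd : (S c d < +oo)%E by apply: le_lt_trans fin; rewrite leeDr.
have hab : (S Fa Fb = (2 * pi)%:E * S a b)%E := plancherel_first_variable ia ib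
  Sab.
have hcd : (S Fc Fd = (2 * pi)%:E * S c d)%E := plancherel_first_variable ic id
  Scd.
(* The first pass works on the pairs [(a, b)] and [(c, d)], the second on [(Fa, Fc)] and [(Fb, Fd)];
   the sum of the four squares does not depend on the pairing. *)
have E1 : (S Fa Fc + S Fb Fd = (2 * pi)%:E * (S a b + S c d))%E.
  rewrite (ge0_muleDr _ (S_ge0 a b) (S_ge0 c d)) -hab -hcd.
  rewrite -(SD mFa mFc mFb mFd) -(SD mFa mFb mFc mFd).
  by apply: eq_integral => z _; rewrite addrACA.
(* Plancherel in the first variable is also what makes the input of the second pass square
   integrable. *)
have fin2 : (S Fa Fc + S Fb Fd < +oo)%E.
  by rewrite E1 lte_mul_pinfty ?lee_fin.
have Sac : (S Fa Fc < +oo)%E by apply: le_lt_trans fin2; rewrite leeDl.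
have Sbd : (S Fb Fd < +oo)%E by apply: le_lt_trans fin2; rewrite leeDr.
have iFa u := integrable_slice_transform u ia ib.
have iFb u := integrable_slice_transform u ib (integrable_EFinN ia).
have iFc u := integrable_slice_transform u ic id.
have iFd u := integrable_slice_transform u id (integrable_EFinN ic).
have hac := plancherel_second_variable mFa mFc iFa iFc Sac.
have hbd := plancherel_second_variable mFb mFd iFb iFd Sbd.
have m1 := measurable_second_variable mFa mFc.
have m2 := measurable_second_variable mFc (mN mFa).
have m3 := measurable_second_variable mFb mFd.
have m4 := measurable_second_variable mFd (mN mFb).
rewrite (SD m1 m2 m3 m4) hac hbd -(ge0_muleDr _ (S_ge0 _ _) (S_ge0 _ _)) E1.
by rewrite muleA -EFinM expr2.
Qed.

End both_variables.
End four_components.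

(** * The quaternion Fourier transform *)

Section quaternion_fourier_norm.
Context {R : realType}.
Notation mu := (@lebesgue_measure R).
Notation mu2 := (@lebesgue_measure R \x @lebesgue_measure R)%E.
Implicit Types (q : quat R) (f g : plane R -> quat R).

Definition qsqr q : R := qr q ^+ 2 + qi q ^+ 2 + qj q ^+ 2 + qk q ^+ 2.

Lemma qsqr_ge0 q : 0 <= qsqr q.
Proof. by rewrite !addr_ge0 ?sqr_ge0. Qed.

(** The factors [1] and [-1] match the sign [e] of [iterated_transformE]; the minus signs come from
    [j^2 = -1] and [k j = -i] acting through the kernel on the right. *)
Lemma qft_integrandE q (s t : R) :
  qexp (- s *: unit_i R) * q * qexp (- t *: unit_j R) = Quat
  (cos t * (cos s * qr q + sin s * qi q) + sin t * (1 * (cos s * qj q +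
    sin s * qk q)))
  (cos t * (cos s * qi q + sin s * - qr q) + sin t * (1 * (cos s * qk q +
    sin s * - qj q)))
  (cos t * (cos s * qj q + sin s * qk q) + sin t * (-1 * (cos s * qr q +
    sin s * qi q)))
  (cos t * (cos s * qk q + sin s * - qj q) + sin t * (-1 * (cos s * qi q +
    sin s * - qr q))).
Proof. by rewrite qexp_i qexp_j !cosN !sinN; congr Quat => /=; ring. Qed.

Definition qintegrable f : Prop :=
  [/\ mu2.-integrable setT (EFin \o (fun z => qr (f z))),
      mu2.-integrable setT (EFin \o (fun z => qi (f z))),
      mu2.-integrable setT (EFin \o (fun z => qj (f z))) &
      mu2.-integrable setT (EFin \o (fun z => qk (f z)))].

Definition qsqr_integrable f : Prop :=
  mu2.-integrable setT (EFin \o (fun z => qsqr (f z))).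

Section transform.
Context f (if_ : qintegrable f).

Let fr z := qr (f z).
Let fi z := qi (f z).
Let fj z := qj (f z).
Let fk z := qk (f z).

Let ir : mu2.-integrable setT (EFin \o fr). Proof. by have [] := if_. Qed.
Let ii : mu2.-integrable setT (EFin \o fi). Proof. by have [] := if_. Qed.
Let ij : mu2.-integrable setT (EFin \o fj). Proof. by have [] := if_. Qed.
Let ik : mu2.-integrable setT (EFin \o fk). Proof. by have [] := if_. Qed.

Let Fr y u := slice_transform fr fi y u.
Let Fi y u := slice_transform fi (fun z => - fr z) y u.
Let Fj y u := slice_transform fj fk y u.
Let Fk y u := slice_transform fk (fun z => - fj z) y u.

Lemma qftE u v : qft f (u, v) = Quat
  (rot_transform (Fr ^~ u) (Fj ^~ u) v)
  (rot_transform (Fi ^~ u) (Fk ^~ u) v)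
  (rot_transform (Fj ^~ u) (fun y => - Fr y u) v)
  (rot_transform (Fk ^~ u) (fun y => - Fi y u) v).
Proof.
(* Inserting the factors 1 and -1 gives each second argument of [rot_transform] the form required by
   [iterated_transformE]. *)
have e1 (S : R -> R) : S = (fun y => 1 * S y) by apply/funext => y;
  rewrite mul1r.
have eN (S : R -> R) : (fun y => - S y) = (fun y => -1 * S y).
  by apply/funext => y; rewrite mulN1r.
rewrite (e1 (Fj ^~ u)) (e1 (Fk ^~ u)) (eN (Fr ^~ u)) (eN (Fi ^~ u)).
rewrite /qft /qintegral; congr Quat.
- rewrite -[RHS]iterated_transformE//; apply: eq_Rintegral => z _.
  by rewrite qft_integrandE.
- rewrite -[RHS]iterated_transformE//; [|exact: integrable_EFinN|exact:
    integrable_EFinN].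
  by apply: eq_Rintegral => z _; rewrite qft_integrandE.
(* Here the function with the inserted factor 1 is the first argument, so that factor is removed
   again. *)
- rewrite -[X in rot_transform X]e1 -[RHS]iterated_transformE//;
    apply: eq_Rintegral => z _.
  by rewrite qft_integrandE.
- rewrite -[X in rot_transform X]e1 -[RHS]iterated_transformE//;
    [|exact: integrable_EFinN|exact: integrable_EFinN].
  by apply: eq_Rintegral => z _; rewrite qft_integrandE.
Qed.

Lemma qsqr_qft z : qsqr (qft f z) = iterated_sqr_norm fr fi fj fk z.
Proof.
have reorder (x y s t : R) : x + y + s + t = (x + s) + (y + t) by ring.
by case: z => u v; rewrite qftE; exact: reorder.
Qed.

Lemma measurable_qsqr_qft : measurable_fun [set: plane R] (fun z =>
  qsqr (qft f z)).
Proof.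
have h := measurable_iterated_sqr_norm ir ii ij ik.
have -> : (fun z => qsqr (qft f z)) = iterated_sqr_norm fr fi fj fk.
  by apply/funext => z; exact: qsqr_qft.
exact: h.
Qed.

Lemma plancherel_qsqr : (\int[mu2]_z (qsqr (f z))%:E < +oo)%E ->
  (\int[mu2]_z (qsqr (qft f z))%:E =
   ((2 * pi) ^+ 2)%:E * \int[mu2]_z (qsqr (f z))%:E)%E.
Proof.
have -> : (\int[mu2]_z (qsqr (f z))%:E =
    \int[mu2]_z ((fr z ^+ 2 + fi z ^+ 2) + (fj z ^+ 2 + fk z ^+ 2))%:E)%E.
  by apply: eq_integral => z _; rewrite /qsqr addrA.
move=> fin; under [LHS]eq_integral do rewrite qsqr_qft.
exact: plancherel_four_components.
Qed.

Lemma integrable_qft_integrand w :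
  qintegrable (fun z => qexp (- (z.1 * w.1) *: unit_i R) * f z * qexp (- (z.2 *
    w.2) *: unit_j R)).
Proof.
have m1 : measurable_fun [set: plane R] (fun z => z.1 * w.1).
  have : measurable_fun [set: R * R] (fun z =>
    z.1 * w.1) by exact: measurable_funM.
  exact.
have m2 : measurable_fun [set: plane R] (fun z => z.2 * w.2).
  have : measurable_fun [set: R * R] (fun z =>
    z.2 * w.2) by exact: measurable_funM.
  exact.
have I (e : R) (a b c d : plane R -> R) : mu2.-integrable setT (EFin \o a) ->
    mu2.-integrable setT (EFin \o b) -> mu2.-integrable setT (EFin \o c) ->
    mu2.-integrable setT (EFin \o d) -> mu2.-integrable setT (EFin \o (fun z :
      plane R =>
    cos (z.2 * w.2) * (cos (z.1 * w.1) * a z + sin (z.1 * w.1) * b z) +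
    sin (z.2 * w.2) * (e * (cos (z.1 * w.1) * c z + sin (z.1 * w.1) * d z)))).
  move=> ia ib ic id; apply: integrable_bounded_comb => //.
    exact: integrable_bounded_comb.
  by apply: integrable_EFinZl => //; exact: integrable_bounded_comb.
have inr := integrable_EFinN ir; have ini := integrable_EFinN ii;
  have inj_ := integrable_EFinN ij.
split.
- apply: eq_integrable (I 1 _ _ _ _ ir ii ij ik) => // z _.
  exact: (congr1 (EFin \o @qr R) (esym (qft_integrandE (f z) _ _))).
- apply: eq_integrable (I 1 _ _ _ _ ii inr ik inj_) => // z _.
  exact: (congr1 (EFin \o @qi R) (esym (qft_integrandE (f z) _ _))).
- apply: eq_integrable (I (-1) _ _ _ _ ij ik ir ii) => // z _.
  exact: (congr1 (EFin \o @qj R) (esym (qft_integrandE (f z) _ _))).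
- apply: eq_integrable (I (-1) _ _ _ _ ik inj_ ii inr) => // z _.
  exact: (congr1 (EFin \o @qk R) (esym (qft_integrandE (f z) _ _))).
Qed.

End transform.

Lemma qintegralD f g : qintegrable f -> qintegrable g ->
  qintegral (fun z => f z + g z) = qintegral f + qintegral g.
Proof.
move=> [fr fi fj fk] [gr gi gj gk]; rewrite /qintegral; congr Quat;
  exact: (@RintegralD _ _ _ mu2).
Qed.

Lemma qftD f g w : qintegrable f -> qintegrable g ->
  qft (fun z => f z + g z) w = qft f w + qft g w.
Proof.
move=> fi gi; rewrite /qft.
rewrite -(qintegralD (integrable_qft_integrand fi w) (integrable_qft_integrand
  gi w)).
by congr qintegral; apply/funext => z; rewrite mulrDr mulrDl.
Qed.

Lemma qintegrable_add f g : qintegrable f -> qintegrable g ->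
  qintegrable (fun z => f z + g z).
Proof.
by move=> [fr fi fj fk] [gr gi gj gk]; split; exact: integrable_EFinD.
Qed.

(** Polarization: the left side is the Euclidean inner product of the component vectors, which is
    symmetric, so the single sum [p + q] suffices. *)
Lemma qr_mul_conj (p q : quat R) :
  qr (p * qconj q) = 2^-1 * (qsqr (p + q) - qsqr p - qsqr q).
Proof. by rewrite /qsqr /=; field. Qed.

End quaternion_fourier_norm.

(** * Integrals of almost everywhere equal functions *)

Section ae_equal_integrals.
Context d (T : measurableType d) (R : realType) (mu : {measure set T ->
  \bar R}).
Implicit Types f g : T -> \bar R.

Import HBNNSimple.

(* No measurability is assumed: the integral of a nonnegative function is a
   supremum over simple functions, each of which can be cut off on a null set.
     *)
Lemma ge0_ae_le_integral f g : (forall x, (0 <= f x)%E) ->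
  (forall x, (0 <= g x)%E) ->
  {ae mu, forall x, f x = g x} -> (\int[mu]_x f x <= \int[mu]_x g x)%E.
Proof.
move=> f0 g0 [N [mN N0 fgN]].
rewrite !ge0_integralTE//; apply: ge_ereal_sup => _ [h hf <-].
pose h' := proj_nnsfun h (measurableC mN).
have h'E x : h' x = if x \in N then 0 else h x.
  by rewrite /h' /= mindicE in_setC; case: (x \in N); rewrite ?mulr0 ?mulr1.
have -> : sintegral mu h = sintegral mu h'.
  rewrite -!integralT_nnsfun; apply: ge0_ae_eq_integral => //.
  - by apply/measurable_EFinP.
  - by apply/measurable_EFinP.
  - by move=> x _; rewrite lee_fin.
  - by move=> x _; rewrite lee_fin.
  - exists N; split => // x /= /not_implyP[_ hx]; apply: contrapT => xN.
    by apply: hx; apply/esym/congr1/(etrans (h'E x)); rewrite memNset.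
apply: ereal_sup_ubound; exists h' => // x.
have -> : (h' x)%:E = (if x \in N then 0 else h x)%:E by apply/congr1;
  exact: h'E.
case: ifPn => // /negP xN; rewrite (le_trans (hf x))//.
suff -> : f x = g x by [].
by apply: contrapT => fgx; apply: xN; rewrite inE; exact: fgN.
Qed.

(** Used with [f] merely equal almost everywhere to a Borel function, so only one of the two sides
    is known to be Borel measurable. *)
Lemma ae_eq_integralT f g : {ae mu, forall x, f x = g x} ->
  (\int[mu]_x f x = \int[mu]_x g x)%E.
Proof.
move=> fg; have gf : {ae mu, forall x, g x = f x}.
  by apply: filterS fg => x ->.
rewrite integralE [RHS]integralE; congr (_ - _)%E; apply/eqP; rewrite eq_le;
  apply/andP; split; apply: ge0_ae_le_integral => //.
- by apply: filterS fg => x; rewrite !unlock => ->.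
- by apply: filterS gf => x; rewrite !unlock => ->.
- by apply: filterS fg => x; rewrite !unlock => ->.
- by apply: filterS gf => x; rewrite !unlock => ->.
Qed.

End ae_equal_integrals.

(** * Borel representatives and polarization *)

Section reduction_to_borel.
Context {R : realType}.
Notation mu2 := (@lebesgue_measure R \x @lebesgue_measure R)%E.
Implicit Types (q : quat R) (f g : plane R -> quat R).

Lemma qnorm_sqr q : qnorm q ^+ 2 = qsqr q.
Proof.
have E : qr (q * qconj q) = qsqr q by rewrite /qsqr /=; ring.
by rewrite /qnorm E sqr_sqrtr// qsqr_ge0.
Qed.

Lemma qnormE q : qnorm q = Num.sqrt (qsqr q).
Proof. by rewrite -qnorm_sqr sqrtr_sqr ger0_norm// sqrtr_ge0. Qed.

Lemma normr_le_qnorm q (x : R) : x ^+ 2 <= qsqr q -> `|x| <= qnorm q.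
Proof. by move=> xq; rewrite qnormE -sqrtr_sqr ler_wsqrtr. Qed.

Lemma borel_qintegrable f : borel_quat f ->
  (\int[mu2]_x (qnorm (f x))%:E < +oo)%E -> qintegrable f.
Proof.
move=> [mr mi mj mk] fin.
have mq : measurable_fun [set: plane R] (fun z => qsqr (f z)).
  by apply: measurable_funD; [apply: measurable_funD;
    [apply: measurable_funD|]|];
    apply: measurable_funX.
have inorm : mu2.-integrable setT (EFin \o (fun z => qnorm (f z))).
  apply: ge0_integrable => //.
    apply/measurable_EFinP.
    have -> : (fun z => qnorm (f z)) = Num.sqrt \o (fun z => qsqr (f z)).
      by apply/funext => z; exact: qnormE.
    apply: (measurableT_comp _ mq); apply: continuous_measurable_fun.
    exact: sqrt_continuous.
  by move=> z; rewrite lee_fin sqrtr_ge0.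
have bound (a : plane R -> R) : measurable_fun [set: plane R] a ->
    (forall z, a z ^+ 2 <= qsqr (f z)) -> mu2.-integrable setT (EFin \o a).
  move=> ma aq; apply: le_integrable inorm => //; first exact/measurable_EFinP.
  by move=> z _ /=; rewrite lee_fin (le_trans (normr_le_qnorm (aq z)))//
    ler_norm.
split; apply: bound => // z; rewrite /qsqr; have := sqr_ge0 (qr (f z));
  have := sqr_ge0 (qi (f z)); have := sqr_ge0 (qj (f z));
    have := sqr_ge0 (qk (f z)); lra.
Qed.

Lemma borel_qsqr_integrable f : borel_quat f ->
  (\int[mu2]_x (qnorm (f x) ^+ 2)%:E < +oo)%E -> qsqr_integrable f.
Proof.
move=> [mr mi mj mk]; under eq_integral do rewrite qnorm_sqr.
apply: ge0_integrable; last by move=> z; rewrite lee_fin qsqr_ge0.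
apply/measurable_EFinP.
by apply: measurable_funD; [apply: measurable_funD; [apply: measurable_funD|]|];
  apply: measurable_funX.
Qed.

(** At each fixed frequency the two integrands differ on a null set only, so the transforms agree
    everywhere and not just almost everywhere. *)
Lemma ae_qft f g : {ae @lebesgue2 R, forall x, f x = g x} -> qft f = qft g.
Proof.
move=> fg; apply/funext => w; rewrite /qft /qintegral.
by congr Quat; rewrite /Rintegral; congr fine; apply: ae_eq_integralT;
  apply: filterS fg => x /= ->.
Qed.

Lemma ae_qscalar_product f g f' g' :
  {ae @lebesgue2 R, forall x, f x = f' x} -> {ae @lebesgue2 R, forall x,
    g x = g' x} ->
  qscalar_product f g = qscalar_product f' g'.
Proof.
move=> ff gg; apply: ae_eq_integralT.
by apply: (@filterS2 _ _ (ae_filter_ringOfSetsType (@lebesgue2 R)) _ _ _ _ ff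
  gg) => x -> ->.
Qed.

Lemma in_L1_ae f g : borel_quat g -> {ae @lebesgue2 R, forall x, f x = g x} ->
  in_L1 f -> qintegrable g.
Proof.
move=> bg fg [_]; rewrite (ae_eq_integralT (g := fun x => (qnorm (g x))%:E)).
  exact: borel_qintegrable.
by apply: filterS fg => x /= ->.
Qed.

Lemma in_L2_ae f g : borel_quat g -> {ae @lebesgue2 R, forall x, f x = g x} ->
  in_L2 f -> qsqr_integrable g.
Proof.
move=> bg fg [_]; rewrite (ae_eq_integralT (g := fun x =>
  (qnorm (g x) ^+ 2)%:E)).
  exact: borel_qsqr_integrable.
by apply: filterS fg => x /= ->.
Qed.

Lemma qscalar_polarization f g : qsqr_integrable f -> qsqr_integrable g ->
  qsqr_integrable (fun z => f z + g z) ->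
  qscalar_product f g = (2^-1 * (\int[mu2]_z qsqr (f z + g z) -
    \int[mu2]_z qsqr (f z) - \int[mu2]_z qsqr (g z)))%:E.
Proof.
move=> fi gi fgi.
have i1 := integrable_EFinB measurableT fgi fi.
have i2 := integrable_EFinB measurableT i1 gi.
have i3 := integrable_EFinZl 2^-1 measurableT i2.
rewrite -(RintegralB measurableT fgi fi) -(RintegralB measurableT i1 gi).
rewrite -(RintegralZl 2^-1 measurableT i2) /Rintegral fineK;
  last exact: integrable_fin_num i3.
by apply: eq_integral => z _; rewrite qr_mul_conj.
Qed.

Lemma qsqr_integrable_add f g : qsqr_integrable f -> qsqr_integrable g ->
  measurable_fun [set: plane R] (fun z => qsqr (f z + g z)) ->
  qsqr_integrable (fun z => f z + g z).
Proof.
move=> fi gi mfg.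
have i := integrable_EFinZl 2 measurableT (integrable_EFinD measurableT fi gi).
apply: le_integrable i => //; first exact/measurable_EFinP.
move=> z _ /=; rewrite lee_fin (ger0_norm (qsqr_ge0 _)) ger0_norm; last first.
  by apply: mulr_ge0 => //; apply: addr_ge0; exact: qsqr_ge0.
have sq (x y : R) : (x + y) ^+ 2 <= 2 * (x ^+ 2 + y ^+ 2).
  by have := sqr_ge0 (x - y); nra.
rewrite /qsqr /=.
have := sq (qr (f z)) (qr (g z)); have := sq (qi (f z)) (qi (g z)).
by have := sq (qj (f z)) (qj (g z)); have := sq (qk (f z)) (qk (g z)); lra.
Qed.

Lemma qsqr_integrable_qft f : qintegrable f -> qsqr_integrable f ->
  qsqr_integrable (qft f) /\
  \int[mu2]_z qsqr (qft f z) = (2 * pi) ^+ 2 * \int[mu2]_z qsqr (f z).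
Proof.
move=> fi fs; have fin : (\int[mu2]_z (qsqr (f z))%:E < +oo)%E.
  exact: integrable_lty fs.
have E := plancherel_qsqr fi fin; split.
  apply: ge0_integrable.
  - by apply/measurable_EFinP; exact: measurable_qsqr_qft.
  - by move=> z; rewrite lee_fin qsqr_ge0.
  - by rewrite E lte_mul_pinfty ?lee_fin ?sqr_ge0.
rewrite /Rintegral E fineM//; exact: integrable_fin_num fs.
Qed.

(** The norm identity is applied to [f], [g] and [f + g], which is where additivity of [qft] and
    closure of both integrability conditions under sums enter. *)
Lemma plancherel_borel f g : qintegrable f -> qintegrable g ->
  qsqr_integrable f -> qsqr_integrable g ->
  qscalar_product f g =
    ((1 / (2 * pi) ^+ 2)%:E * qscalar_product (qft f) (qft g))%E.
Proof.
move=> fi gi fs gs; have fgi := qintegrable_add fi gi.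
have mfg : measurable_fun [set: plane R] (fun z => qsqr (f z + g z)).
  have [i1 i2 i3 i4] := fgi.
  have m (a : plane R -> R) : mu2.-integrable setT (EFin \o a) ->
      measurable_fun [set: plane R] a.
    by move=> ia; apply/measurable_EFinP; exact: measurable_int ia.
  by apply: measurable_funD; [apply: measurable_funD;
    [apply: measurable_funD|]|];
    apply: measurable_funX; exact: m.
have fgs := qsqr_integrable_add fs gs mfg.
have [Ff EF] := qsqr_integrable_qft fi fs.
have [Fg EG] := qsqr_integrable_qft gi gs.
have [Ffg EFG] := qsqr_integrable_qft fgi fgs.
have D : qft (fun z => f z + g z) = (fun z => qft f z + qft g z).
  by apply/funext => z; exact: qftD.
rewrite D in Ffg EFG.
rewrite (qscalar_polarization fs gs fgs) (qscalar_polarization Ff Fg Ffg).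
rewrite EF EG EFG -EFinM; congr EFin.
have : (2 * pi) ^+ 2 != 0 :> R by rewrite expf_neq0// mulf_neq0// gt_eqF//
  pi_gt0.
by move: ((2 * pi) ^+ 2) => c c0; field.
Qed.

End reduction_to_borel.

Theorem theorem2p2 (R : realType) (f g : plane R -> quat R)
  (f2 : in_L2 f) (g2 : in_L2 g) (f1 : in_L1 f) (g1 : in_L1 g) :
  qscalar_product f g =
    ((1 / (2 * pi) ^+ 2)%:E * qscalar_product (qft f) (qft g))%E.
Proof.
(* One Borel representative serves both the L^1 and the L^2 condition, since each integral depends
   only on the almost everywhere class. *)
have [[f0 bf ff0] _] := f1; have [[g0 bg gg0] _] := g1.
rewrite (ae_qft ff0) (ae_qft gg0) (ae_qscalar_product ff0 gg0).
apply: plancherel_borel.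
- exact: in_L1_ae bf ff0 f1.
- exact: in_L1_ae bg gg0 g1.
- exact: in_L2_ae bf ff0 f2.
- exact: in_L2_ae bg gg0 g2.
Qed.
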